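(* Let $F_0$ be a distribution on $\mathbb{R}_+$ with density $f_0$ and mean $1$, with associated age distribution $F$, hazard rate $\eta$, and observed hazard rate distributions $G$ (non-synchronized) and $G_0$ (synchronized). For each $N$, consider a local memory system with $N$ items, memory size $C_N$ with $1\le C_N<N$, and independent stationary renewal request processes $\Phi_1,\dots,\Phi_N$ with intensities $\lambda_1^{(N)}\ge\dots\ge\lambda_N^{(N)}>0$, where $\Phi_i$ has inter-arrival distribution $F_0(\lambda_i^{(N)}t)$. Assume: (i) $L_N(\lambda):=\frac1N\sum_{i=1}^N\mathbf{1}_{\{\lambda_i^{(N)}\le\lambda\}}$ converges weakly to a probability distribution $L$ with no atom at $0$; (ii) for each $N\ge1$ and $1\le i\ne j\le N$, $P^0_\Phi(X_i^{(N)}=X_j^{(N)})=0$, where $X_i^{(N)}$ are the observed hazard rates at time $0$ and $\Phi=\sum_{i=1}^N\Phi_i$. Suppose $\{L_N\}_{N\ge1}$ is uniformly integrable. Let $G_\infty(x)=\int_0^\infty G(x/\lambda)L(d\lambda)$ and let $Q_\infty$ be its quantile function. Let $c\in(0,1]$ be such that $1-c$ is a continuity point of $Q_\infty$ and that $\theta^*:=Q_\infty(1-c)\notin D_L\cdot D_{G_0}$, and suppose $C_N/N\to c$ as $N\to\infty$. Let $\theta_N$ be the deterministic threshold satisfying the average memory constraint, and $M_{\theta_N}$ the miss probability of the threshold policy $\mathcal{C}_{\theta_N}$ in the $N$-th system. Then $$\lim_{N\to\infty}M_{\theta_N}=\frac{\int_0^\infty\lambda\,G_0\!\left(\frac{\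theta^*}{\lambda}\right)L(d\lambda)}{\int_0^\infty\lambda\,L(d\lambda)}.$$
   Context: Framework: $(\Omega,\mathcal{F},P)$ carries a measurable flow $\{\vartheta_t\}$ preserving $P$, and stationarity means compatibility with the flow. The Palm probability of a stationary point process $\Phi$ of intensity $\lambda=\mathrm{E}[\Phi((0,1])]$ is $P^0_\Phi(A)=\frac1\lambda\mathrm{E}[\int_{(0,1]}\mathbf{1}_A(\vartheta_s\omega)\Phi(ds)]$. A stationary renewal process is a stationary simple point process whose inter-arrival times are i.i.d. under its Palm probability. Base distributions: $F(t)=\int_0^t(1-F_0(s))ds$, $\eta(t)=f_0(t)/(1-F_0(t))$, $G(x)=\int_{\eta^{-1}([0,x])}F(dt)$, $G_0(x)=\int_{\eta^{-1}([0,x])}F_0(dt)$. Observed hazard rates: $\eta_i(t)=\lambda_i^{(N)}\eta(\lambda_i^{(N)}t)$, $\tau_i^-(t)$ is the last point of $\Phi_i$ strictly before $t$, the stochastic intensity of $\Phi_i$ with respect to its natural history is $\lambda_i(t)=\eta_i(t-\tau_i^-(t))$, and $X_i^{(N)}=\lambda_i(0)$; under $P$, $X_i^{(N)}$ has distribution function $G(x/\lambda_i^{(N)})$, and under $P^0_{\Phi_i}$ it has distribution function $G_0(x/\lambda_i^{(N)})$. Threshold policy: $\mathcal{C}_\theta(t)=\{i:\lambda_i(t)>\theta\}$. The threshold is $\theta_N=\inf\{\theta\ge0:\sum_{i=1}^NP(\lambda_i(0)>\theta)\le C_N\}$, and it is a standing assumption that it attains equality, i.e. $\int_0^\infty G(\theta_N/\lambda)L_N(d\lambda)=1-C_N/N$.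 With $\lambda^N=\sum_{i=1}^N\lambda_i^{(N)}$, the miss probability is $M_{\theta_N}=\sum_{i=1}^N\frac{\lambda_i^{(N)}}{\lambda^N}P^0_{\Phi_i}(i\notin\mathcal{C}_{\theta_N}(0))$. $\{L_N\}$ is uniformly integrable if for every $\epsilon>0$ there is $K\ge0$ with $\sup_{N\ge1}\frac1N\sum_{i:\,\lambda_i^{(N)}\ge K}\lambda_i^{(N)}\le\epsilon$. $Q_\infty(p)=\inf\{x\ge0:G_\infty(x)\ge p\}$, $p\in[0,1]$. $D_L$ and $D_{G_0}$ are the sets of discontinuity points of $L$ and $G_0$, and $D_L\cdot D_{G_0}=\{\lambda x:\lambda\in D_L,\ x\in D_{G_0}\}$. *)

(* Defs.v *)
From HB Require Import structures.
From mathcomp Require Export all_boot all_order all_algebra.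
From mathcomp Require Export all_classical all_reals all_analysis measurable_realfun.
Export Order.TTheory GRing.Theory Num.Theory.
Export numFieldNormedType.Exports.

#[export] Set Implicit Arguments.
#[export] Unset Strict Implicit.
#[export] Unset Printing Implicit Defensive.

Local Open Scope ring_scope.
Local Open Scope classical_set_scope.

Section finite_sum_of_measures.
Context d (T : measurableType d) (R : realType) (N : nat).
Variable m : 'I_N -> {measure set T -> \bar R}.

Definition sum_measure (A : set T) : \bar R := (\sum_(i < N) m i A)%E.

Let sum_measure0 : sum_measure set0 = 0%E.
Proof. by rewrite /sum_measure big1. Qed.

Let sum_measure_ge0 B : (0 <= sum_measure B)%E.
Proof. by rewrite /sum_measure; apply: sume_ge0. Qed.

Let sum_measure_sigma_additive : semi_sigma_additive sum_measure.
Proof.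
move=> F mF tF mUF; rewrite [X in _ --> X](_ : _ =
    limn (fun n => \sum_(0 <= i < n) sum_measure (F i))%E).
  by apply: is_cvg_ereal_nneg_natsum => k _; exact: sume_ge0.
rewrite nneseries_sum//; apply: eq_bigr => /= i _.
exact: measure_semi_bigcup.
Qed.

HB.instance Definition _ := isMeasure.Build _ _ _ sum_measure
  sum_measure0 sum_measure_ge0 sum_measure_sigma_additive.
End finite_sum_of_measures.

Section real_distributions.
Context {R : realType}.
Implicit Types (mu : set R -> \bar R) (f : R -> R).

Definition distr_fun mu (x : R) : R := fine (mu `]-oo, x]).

Definition discontinuities f : set R := [set x | ~ {for x, continuous f}].

Definition has_density mu f := [/\ measurable_fun setT f, forall t, 0 <= f t &
  forall A, measurable A -> mu A = (\int[lebesgue_measure]_(t in A) (f t)%:E)%E].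

(* The empirical law of the numbers lam i; its distribution function is
   x |-> #{i | lam i <= x} / N, see distr_fun_empirical. *)
Definition empirical (N : nat) (lam : 'I_N -> R)
    : {measure set R -> \bar R} :=
  mscale (N%:R^-1)%:nng (sum_measure (fun i => \d_(lam i))).

Lemma distr_fun_empirical (N : nat) (lam : 'I_N -> R) x :
  distr_fun (empirical lam) x = N%:R^-1 * \sum_(i < N) (lam i <= x)%R%:R.
Proof.
rewrite /distr_fun [X in fine X](_ : _ =
    (N%:R^-1)%:E * \sum_(i < N) ((lam i <= x)%R%:R)%:E)%E.
  by rewrite sumEFin -EFinM.
congr (_ * _)%E; apply: eq_bigr => i _.
by rewrite /= /dirac indicE mem_setE in_itv.
Qed.

Definition weak_cvg (mu_ : nat -> set R -> \bar R) mu :=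
  forall x, {for x, continuous (distr_fun mu)} ->
    distr_fun (mu_ N) x @[N --> \oo] --> distr_fun mu x.

Definition uniformly_integrable (lam : forall N, 'I_N -> R) :=
  forall e : R, 0 < e -> exists2 K : R, 0 <= K &
    forall N, (0 < N)%N ->
      N%:R^-1 * \sum_(i < N | K <= lam N i) lam N i <= e.

End real_distributions.

Section base_distribution.
Context {R : realType}.
Variables (F0 : probability R R) (f0 : R -> R).

Definition age_distribution (F : probability R R) :=
  forall t, 0 <= t -> F `]-oo, t] =
    (\int[lebesgue_measure]_(s in `[0%R, t]) (1 - distr_fun F0 s)%R%:E)%E.

(* Where F0 = 1 the quotient is 0 (inverse of 0); this set of t is null for
   both F0 and F. *)
Definition hazard (t : R) : R := f0 t / (1 - distr_fun F0 t).

(* With H := F this is G and with H := F0 this is G_0. The hazard rate is a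
   function on [0, +oo[, hence the intersection; the value is 0 for x < 0. *)
Definition hazard_distr (H : probability R R) (x : R) : R :=
  fine (H (hazard @^-1` `[0, x] `&` `[0, +oo[)).

End base_distribution.

Section point_processes.
Context {R : realType} d {T : measurableType d}.
Variables (P : probability T R) (theta : R -> T -> T).

Record is_flow : Prop := IsFlow {
  flow_measurable : measurable_fun setT (fun x : R * T => theta x.1 x.2) ;
  flow0 : forall w, theta 0 w = w ;
  flowD : forall s t w, theta (s + t) w = theta s (theta t w) ;
  flow_invariant : forall t A, measurable A -> P (theta t @^-1` A) = P A }.

Section one_process.
Variable Phi : T -> {measure set R -> \bar R}.

(* Random locally finite counting measure *)
Definition integer_valued := forall w (a b : R) B, measurable B ->
  B `<=` `[a, b] -> exists n : nat, Phi w B = n%:R%:E.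

Definition simple := {ae P, forall w, forall t, (Phi w [set t] <= 1)%E}.

Definition stationary := forall w t B, measurable B ->
  Phi (theta t w) B = Phi w [set s + t | s in B].

Definition intensity : \bar R := (\int[P]_w Phi w `]0%R, 1%R])%E.

(* The Palm probability, as a set function *)
Definition palm (A : set T) : \bar R :=
  ((fine intensity)^-1%:E *
   \int[P]_w \int[Phi w]_(s in `]0%R, 1%R]) (\1_A (theta s w))%:E)%E.

(* The points ... < T_{-1} < T_0 <= 0 < T_1 < T_2 < ... of a simple process. *)
Definition point (n : int) (w : T) : R :=
  if 0 < n then inf [set t : R | 0 < t /\ (n%:~R%:E <= Phi w `]0%R, t])%E]
  else sup [set t : R | t <= 0 /\ ((1 - n)%:~R%:E <= Phi w `[t, 0%R])%E].

Definition interarrival (n : int) (w : T) : R := point (n + 1) w - point n w.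

(* tau^-(t), the last point strictly before t *)
Definition last_before (t : R) (w : T) : R :=
  sup [set s : R | s < t /\ (0 < Phi w [set s])%E].

Definition history : set (set T) :=
  <<s [set E | exists B, exists U : set (\bar R),
    [/\ measurable B, measurable U & E = (fun w => Phi w B) @^-1` U] ] >>.

End one_process.

(* Q is a set function because it is used with Palm probabilities. *)
Definition iid_with_distr (Q : set T -> \bar R) (X : int -> T -> R)
    (H : R -> R) :=
  (forall n t, Q [set w | X n w <= t] = (H t)%:E) /\
  (forall (s : seq int) (B : int -> set R), uniq s ->
    (forall n, measurable (B n)) ->
    Q [set w | forall n, n \in s -> B n (X n w)] =
    (\prod_(n <- s) fine (Q (X n @^-1` B n)))%:E).

(* The intensity of a stationary renewal process and the distribution function
   H of its inter-arrival times are part of the predicate. *)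
Record stationary_renewal (Phi : R.-ker T ~> R) (l : R) (H : R -> R) : Prop :=
  StationaryRenewal {
    renewal_integer : integer_valued Phi ;
    renewal_simple : simple Phi ;
    renewal_stationary : stationary Phi ;
    renewal_intensity : intensity Phi = l%:E ;
    renewal_iid : iid_with_distr (palm Phi) (interarrival Phi) H }.

Definition independent_processes (N : nat) (Phi : 'I_N -> R.-ker T ~> R) :=
  forall E : 'I_N -> set T, (forall i, history (Phi i) (E i)) ->
    P (\bigcap_(i in [set: 'I_N]) E i) = (\prod_(i < N) fine (P (E i)))%:E.

Definition superposition (N : nat) (Phi : 'I_N -> R.-ker T ~> R) (w : T)
    : {measure set R -> \bar R} :=
  sum_measure (fun i => Phi i w).

End point_processes.

Section memory_system.
Context {R : realType} d {T : measurableType d}.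
Variables (P : probability T R) (theta : R -> T -> T).
Variables (F0 : probability R R) (f0 : R -> R).
Variables (N : nat) (lam : 'I_N -> R) (Phi : 'I_N -> R.-ker T ~> R).

Record memory_system : Prop := MemorySystem {
  system_flow : is_flow P theta ;
  system_pos : forall i, 0 < lam i ;
  system_sorted : forall i j : 'I_N, (i <= j)%N -> lam j <= lam i ;
  system_independent : independent_processes P Phi ;
  system_renewal : forall i, stationary_renewal P theta (Phi i) (lam i)
    (fun t => distr_fun F0 (lam i * t)) }.

Definition item_hazard (i : 'I_N) (t : R) : R :=
  lam i * hazard F0 f0 (lam i * t).

(* The stochastic intensity lambda_i(t) of Phi i for its natural history *)
Definition rate (i : 'I_N) (t : R) (w : T) : R :=
  item_hazard i (t - last_before (Phi i) t w).

Definition observed_hazard (i : 'I_N) (w : T) : R := rate i 0 w.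

Definition policy (th : R) (t : R) (w : T) : set 'I_N :=
  [set i | th < rate i t w].

Definition threshold (C : nat) : R :=
  inf [set th : R | 0 <= th /\
    (\sum_(i < N) P [set w | (th < rate i 0 w)%R] <= C%:R%:E)%E].

Definition miss_probability (th : R) : R :=
  \sum_(i < N) lam i / (\sum_(j < N) lam j) *
    fine (palm P theta (Phi i) [set w | ~ policy th 0 w i]).

End memory_system.

Section limit_system.
Context {R : realType}.
Variables (G : R -> R) (L : probability R R).

(* The domain is ]0, +oo[ because x / 0 = 0; L has no mass at 0. *)
Definition limit_distr (x : R) : R :=
  (\int[L]_(l in `]0%R, +oo[) G (x / l))%R.

(* For p < 1 the set is not empty; at p = 1 it may be, and inf is then 0. *)
Definition limit_quantile (p : R) : R :=
  inf [set x : R | 0 <= x /\ p <= limit_distr x].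

End limit_system.

(* Main.v *)
(* Under the Palm probability of Phi_i the age at time 0 is an inter-arrival time,
   so the miss probability of item i is G_0(theta_N / lambda_i) and
   M_{theta_N} = (int l G_0(theta_N / l) L_N(dl)) / (int l L_N(dl)).

   If mu is a probability with distribution function H, then Tonelli's theorem
   gives int H(x / l) L_N(dl) = int L_N(x / y) mu(dy), and
   int l H(x / l) L_N(dl) = int A_N(x / y) mu(dy), where A_N(u) is the integral of
   l over ]0, u] against L_N. The layer-cake formula
   A_N(u) = int_0^oo (L_N(u) - L_N(r))^+ dr transfers the convergence of L_N to A_N
   at every continuity point of L, and uniform integrability extends it to the
   total mass. Since L_N and A_N are nondecreasing, the convergence is preserved
   along x_N -> x, and dominated convergence in y applies as soon as x / y is a
   continuity point of L for mu-almost every y, that is, when x is not a product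
   of an atom of L and an atom of mu. For mu with distribution function G this
   holds for all but countably many x; combined with the continuity of the quantile
   function it gives theta_N -> theta^*. For mu with distribution function G_0 and
   x = theta^* it is the hypothesis on D_L . D_{G_0}. *)

From HB Require Import structures.
From mathcomp Require Import lra.
Require Import Defs.

Local Open Scope ring_scope.
Local Open Scope classical_set_scope.

(** * The Palm law of the observed hazard rate *)

(** The half-lines are stable under intersection and generate the Borel sets, and the []-oo, n]]
    cover the line with finite mass. *)
Lemma measure_eq_Nyc (R : realType) (m1 m2 : {measure set R -> \bar R}) :
  (forall x, m1 `]-oo, x] < +oo)%E ->
  (forall x, m1 `]-oo, x] = m2 `]-oo, x]) ->
  forall A, measurable A -> m1 A = m2 A.
Proof.
move=> m1oo m12 A mA.
pose G : set (set R) := [set B | exists x, B = `]-oo, x]%classic].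
have sG : <<s G >> A.
  move: mA; have -> : (@measurable _ R) = _ := RGenOInfty.measurableE R.
  apply: smallest_sub.
    exact: smallest_sigma_algebra.
  move=> _ [x ->]; rewrite -setCitvl -setTD.
  have [_ + _] := @smallest_sigma_algebra _ setT G; apply.
  by apply: sub_gen_smallest; exists x.
apply: (@g_sigma_algebra_measure_unique _ _ _ G _ (fun n => `]-oo, n%:R]%classic)
  _ _ m1 m2) => //.
- by move=> _ [x ->]; exact: measurable_itv.
- by move=> n; exists n%:R.
- rewrite -subTset => x _ /=; exists (Num.truncn x).+1 => //=.
  by rewrite in_itv/= ltW// truncnS_gt.
- move=> _ _ [x ->] [y ->]; exists (Order.min x y).
  by apply/seteqP; split=> z /=; rewrite !in_itv/= le_min => /andP.
- by move=> _ [x ->].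
Qed.

(* The atom is the point where the distribution function of nu restricted to B
   first becomes nonzero: being integer valued, it jumps there. *)
Lemma integer_measure_atom (R : realType) (nu : {measure set R -> \bar R})
    (a b : R) (B : set R) :
  (forall B, measurable B -> B `<=` `[a, b] -> exists n : nat, nu B = n%:R%:E) ->
  measurable B -> B `<=` `[a, b] -> nu B != 0%E ->
  exists2 x, B x & (0 < nu [set x])%E.
Proof.
move=> nuZ mB Bab nuB.
have mI A : measurable A -> measurable (B `&` A) by move=> mA; exact: measurableI.
have BIZ A : measurable A -> exists n : nat, nu (B `&` A) = n%:R%:E.
  by move=> mA; apply: nuZ; [exact: mI|move=> x [/Bab]].
pose S := [set t : R | nu (B `&` `]-oo, t]) != 0%E].
have Sb : S b.
  rewrite /S/= setIidl// => x /Bab /=; rewrite !in_itv/= => /andP[_ ->//].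
have Sa : lbound S a.
  move=> t St; rewrite leNgt; apply/negP => ta; move: St; rewrite /S/=.
  rewrite (_ : _ `&` _ = set0) ?measure0 ?eqxx//.
  rewrite -subset0 => x [/Bab /=]; rewrite !in_itv/= => /andP[ax _] xt.
  by move: (le_lt_trans (le_trans ax xt) ta); rewrite ltxx.
have iS : has_inf S by split; [exists b|exists a].
pose u := inf S.
have St t : u < t -> S t.
  move=> ut; have [s Ss st] : exists2 s, S s & s < t by exact: inf_lt iS.1 ut.
  move: Ss; rewrite /S/=; apply: contra_neq => nu0.
  apply: (subset_measure0 _ _ _ nu0); [exact: mI|exact: mI|].
  by apply: setIS; apply: subset_itvl; rewrite bnd_simp ltW.
have NSt t : t < u -> nu (B `&` `]-oo, t]) = 0%E.
  move=> tu; apply: contrapT => /eqP St0.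
  by move: (ge_inf iS.2 St0); rewrite leNgt tu.
have nuNu : nu (B `&` `]-oo, u[) = 0%E.
  rewrite (_ : _ `&` _ = \bigcup_k (B `&` `]-oo, u - k.+1%:R^-1])).
    apply: measure_negligible; first by apply: bigcupT_measurable => k; exact: mI.
    apply: negligible_bigcup => k; exists (B `&` `]-oo, u - k.+1%:R^-1]).
    by split => //; [exact: mI|apply: NSt; rewrite ltrBlDr ltrDl].
  apply/seteqP; split=> [x [Bx]|x [k _ [Bx]]] /=; rewrite in_itv/=.
    move=> /ltr_add_invr[k xku]; exists k => //; split => //=.
    by rewrite in_itv/= lerBrDr ltW.
  by move=> xk; split => //; rewrite in_itv/= (le_lt_trans xk)// ltrBlDr ltrDl.
(* To the right of [u] the masses are nonzero integers, hence at least 1; continuity from above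
   carries this bound to [u]. *)
have nuu : nu (B `&` `]-oo, u]) != 0%E.
  have : nu (B `&` `]-oo, u + k.+1%:R^-1]) @[k --> \oo] --> nu (B `&` `]-oo, u]).
    rewrite (itvNycEbigcap false) -bigcapIr; last by exists 0%N.
    apply: (@nonincreasing_cvg_mu _ _ _ nu (fun k => B `&` `]-oo, u + k.+1%:R^-1])).
    - by have [n ->] := BIZ `]-oo, u + 1%:R^-1]%classic (measurable_itv _); rewrite ltry.
    - by move=> k; exact: mI.
    - by apply: bigcapT_measurable => k; exact: mI.
    - move=> m n mn; apply/subsetPset; apply: setIS; apply: subset_itvl.
      by rewrite bnd_simp lerD2l lef_pV2 ?posrE// ler_nat.
  move=> nucvg; have : (1%:E <= nu (B `&` `]-oo, u]))%E.
    rewrite -(cvg_lim _ nucvg)//; apply: lime_ge; first by apply/cvg_ex; eexists; exact: nucvg.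
    apply: nearW => k.
    have : S (u + k.+1%:R^-1) by apply: St; rewrite ltrDl.
    rewrite /S/=; have [[|n] ->] := BIZ `]-oo, u + k.+1%:R^-1]%classic (measurable_itv _).
      by rewrite eqxx.
    by rewrite lee_fin ler1n.
  by apply: contraTneq => ->; rewrite lee_fin ler10.
have nuBu : (nu (B `&` [set u]) != 0)%E.
  apply: contra_neq nuu => nu0.
  by rewrite -(@setUitv1 _ _ _ _ true)// setIUr null_set_setU//; exact: mI.
have Bu : B u.
  apply: contrapT => nBu; move: nuBu; rewrite (_ : _ `&` _ = set0).
    by rewrite measure0 eqxx.
  by rewrite -subset0 => x [Bx /= xu]; apply: nBu; rewrite -xu.
exists u => //; rewrite lt_neqAle measure_ge0 andbT eq_sym.
by move: nuBu; rewrite setIidr// => x ->.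
Qed.

(** * The Palm set function as a probability measure *)

Section palm_measure.
Context {R : realType} d {T : measurableType d}.
Variables (P : probability T R) (theta : R -> T -> T) (Phi : R.-ker T ~> R).
Hypotheses (flow : is_flow P theta) (PhiZ : integer_valued Phi).

(** The inner integral of [palm], written as the kernel mass of a set: measurability in [w] and
    additivity in [A] then come from the kernel. *)
Definition palm_window (A : set T) (w : T) : \bar R :=
  Phi w ([set s | A (theta s w)] `&` `]0, 1]).

Lemma measurable_flow_preimage (A : set T) w :
  measurable A -> measurable [set s | A (theta s w)].
Proof.
move=> mA; have := measurableT_comp (flow_measurable flow) (pair2_measurable w).
by move=> /(_ measurableT _ mA); rewrite setTI.
Qed.

(** The set in [palm_window] is a section of the measurable set [B] of the product. Integer values
    make each [Phi w] finite on []0, 1]], as the measurability of section masses requires. *)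
Lemma measurable_palm_window A :
  measurable A -> measurable_fun setT (palm_window A).
Proof.
move=> mA; pose B : set (T * R) := [set x | A (theta x.2 x.1)].
have mB : measurable B.
  have := measurableT_comp (flow_measurable flow) (@measurable_swap _ _ T R).
  by move=> /(_ measurableT _ mA); rewrite setTI.
have kub : forall w, exists M : R, forall X, measurable X ->
    (mrestr (Phi w) (measurable_itv (Interval (BRight 0%R) (BRight 1%R))) X < M%:E)%E.
  move=> w; have [//||n nE] := @PhiZ w 0 1 `]0%R, 1%R]%classic.
    exact: subset_itv_oc_cc.
  exists n.+1%:R => X mX; apply: (@le_lt_trans _ _ n%:R%:E).
    rewrite -nE /mrestr; apply: le_measure; rewrite ?inE//.
    exact: measurableI.
  by rewrite lte_fin ltr_nat.
have [_] := measurable_prod_subset_xsection_kernel kub mB.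
apply: eq_measurable_fun => w _.
by rewrite /palm_window /mrestr xsectionE.
Qed.

Lemma palmE A : measurable A ->
  palm P theta Phi A =
  ((fine (intensity P Phi))^-1%:E * \int[P]_w palm_window A w)%E.
Proof.
move=> mA; rewrite /palm; congr (_ * _)%E; apply: eq_integral => w _.
rewrite -[RHS]integral_indic//; last exact: measurable_flow_preimage.
Qed.

Let palm0 : palm P theta Phi set0 = 0%E.
Proof.
rewrite palmE// (_ : palm_window set0 = cst 0%E) ?integral0 ?mule0//.
by apply/funext => w; rewrite /palm_window set0I measure0.
Qed.

Let palm_ge0 A : (0 <= palm P theta Phi A)%E.
Proof.
rewrite /palm mule_ge0//.
  rewrite lee_fin invr_ge0 fine_ge0//.
  by apply: integral_ge0 => w _; exact: measure_ge0.
apply: integral_ge0 => w _; apply: integral_ge0 => s _.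
by rewrite lee_fin.
Qed.

Let palm_sigma_additive : semi_sigma_additive (palm P theta Phi).
Proof.
move=> F mF tF mUF; rewrite [X in _ --> X](_ : _ =
    limn (fun n => \sum_(0 <= i < n) palm P theta Phi (F i))%E).
  by apply: is_cvg_ereal_nneg_natsum => k _; exact: palm_ge0.
rewrite palmE//.
have -> : palm_window (\bigcup_n F n) = fun w => (\sum_(n <oo) palm_window (F n) w)%E.
  apply/funext => w; rewrite /palm_window -measure_semi_bigcup//.
  - by rewrite -setI_bigcupl; congr (Phi w (_ `&` _)); apply/seteqP; split.
  - by move=> n; apply: measurableI => //; exact: measurable_flow_preimage.
  - apply/trivIsetP => i j _ _ ij; apply/seteqP; split=> // s [[Fi _] [Fj _]].
    have /seteqP[+ _] : F i `&` F j = set0 by move/trivIsetP : tF; apply.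
    by move=> /(_ (theta s w)); apply.
  - rewrite -setI_bigcupl; apply: measurableI => //.
    by have := measurable_flow_preimage w mUF; congr measurable; apply/seteqP; split.
rewrite integral_nneseries//; last by move=> n; exact: measurable_palm_window.
rewrite -nneseriesZl; last first.
  by move=> n _; apply: integral_ge0 => w _; exact: measure_ge0.
by apply: eq_eseriesr => n _; rewrite palmE.
Qed.

Lemma palm_setT (l : R) : 0 < l -> intensity P Phi = l%:E ->
  palm P theta Phi setT = 1%E.
Proof.
move=> l0 Phil; rewrite palmE// /palm_window.
under eq_integral do rewrite setTI.
by rewrite -/(intensity P Phi) Phil/= -EFinM mulVf// gt_eqF.
Qed.

(** Being defined as a bare set function, [palm] is packed here as a probability, so that null sets
    and image laws can be used. *)
Lemma palm_probability (l : R) : 0 < l -> intensity P Phi = l%:E ->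
  exists Q : probability T R, Q = palm P theta Phi :> (set T -> \bar R).
Proof.
move=> l0 Phil.
pose H := isMeasure.Build _ _ _ (palm P theta Phi) palm0 palm_ge0 palm_sigma_additive.
pose Q0 : {measure set T -> \bar R} := HB.pack (palm P theta Phi) H.
pose H1 := @Measure_isProbability.Build _ _ _ Q0 (palm_setT l0 Phil).
by exists (HB.pack_for (probability T R) (Measure.sort Q0) H1).
Qed.

End palm_measure.

(* sup takes the value 0 on the empty set, hence the case distinction on the
   sign of the level. *)
Lemma measurable_sup_down (R : realType) d (T : measurableType d)
    (A : R -> set T) :
  (forall t, measurable (A t)) ->
  (forall s t, s <= t -> A t `<=` A s) ->
  measurable_fun setT (fun w => sup [set t : R | t <= 0 /\ A t w]).
Proof.
move=> mA ndA; pose S w := [set t : R | t <= 0 /\ A t w].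
have Sub w : has_ubound (S w) by exists 0 => t [].
apply: (measurability _ (RGenOInfty.measurableE R)) => //.
move=> _ [_ [a ->] <-]; rewrite setTI.
(* By monotonicity [S w] is empty exactly when it contains no [- n]. *)
have mS0 : measurable [set w | S w = set0].
  rewrite (_ : [set _ | _] = \bigcap_n ~` A (- n%:R)).
    by apply: bigcapT_measurable => n; exact: measurableC.
  apply/seteqP; split=> w /=.
    move=> Sw0 n _ An.
    suff : S w (- n%:R) by rewrite Sw0.
    by split => //; rewrite oppr_le0.
  move=> nA; rewrite -subset0 => t [t0 At]; apply: (nA (Num.bound (- t)) I).
  by apply: ndA At; rewrite lerNl ltW// archi_boundP// oppr_ge0.
(* For [a < 0] the supremum exceeds [a] when [S w] is empty (value 0) or contains a rational above
   [a]; for [0 <= a] it never does. *)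
have [a0|a0] := ltP a 0.
  rewrite [X in measurable X](_ : _ = [set w | S w = set0] `|`
     \bigcup_(q in [set q : rat | ratr q <= (0:R) /\ a < ratr q]) A (ratr q)).
    apply: measurableU => //; rewrite bigcup_mkcond.
    by apply: bigcupT_measurable_rat => q; case: ifP.
  apply/seteqP; split=> w /=; rewrite in_itv/= andbT.
    have [->|/set0P S0] := eqVneq (S w) set0; first by left.
    move=> /(sup_gt S0)[t [t0 At] at_].
    have [q /andP[aq qt]] := rat_in_itvoo at_; right; exists q.
      by split => //; rewrite (le_trans (ltW qt)).
    by apply: ndA At; exact: ltW.
  rewrite -/(S w) => -[->|[q [q0 aq] Aq]]; first by rewrite sup0.
  by apply: (lt_le_trans aq); apply: ub_le_sup (Sub w) _ _.
rewrite [X in measurable X](_ : _ = set0)//.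
rewrite -subset0 => w /=; rewrite in_itv/= andbT -/(S w).
have [->|/set0P S0] := eqVneq (S w) set0; first by rewrite sup0 ltNge a0.
by rewrite ltNge (le_trans _ a0)//; apply: ge_sup => // t [].
Qed.

Lemma pushforward_probability (R : realType) d (T : measurableType d)
    (Q : probability T R) (f : T -> R) : measurable_fun setT f ->
  exists m : probability R R, forall A, m A = Q (f @^-1` A).
Proof.
move=> mf.
pose X : {mfun T >-> R} :=
  HB.pack_for {mfun T >-> R} f (isMeasurableFun.Build _ _ _ _ f mf).
by exists (distribution Q X).
Qed.

(** * The last points up to time 0 *)

Section points_before_zero.
Context {R : realType} d {T : measurableType d} (Phi : R.-ker T ~> R).

(** The free right end [b] covers both the windows closed at 0 of [point] and the windows open at 0
    that describe the last point strictly before 0. *)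
Lemma measurable_sup_count (k : \bar R) (b : itv_bound R) :
  measurable_fun setT
    (fun w => sup [set t | t <= 0 /\ (k <= Phi w [set` Interval (BLeft t) b])%E]).
Proof.
apply: (@measurable_sup_down _ _ _
  (fun t => [set w | (k <= Phi w [set` Interval (BLeft t) b])%E])) => [t|s t st w /= kw].
  rewrite -[X in measurable X]setTI; apply: measurable_lee => //.
  exact: measurable_kernel.
apply: (le_trans kw); apply: le_measure; rewrite ?inE//.
by apply: subset_itvr; rewrite bnd_simp.
Qed.

Hypothesis PhiZ : integer_valued Phi.

(** An atom at [s < 0] gives mass at least 1 to [[s, 0[]; conversely such a mass on [[t, 0[] forces
    an atom at or to the right of [t]. The counting form is measurable and comparable with
    [point]. *)
Lemma last_before0E w : last_before Phi 0 w =
  sup [set t | t <= 0 /\ (1%:E <= Phi w `[t, 0%R[)%E].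
Proof.
rewrite /last_before.
set A := [set s | _]; set B := [set t | _].
have AB : A `<=` B.
  move=> s [s0 Phis]; split; first exact: ltW.
  have : (0 < Phi w `[s, 0%R[)%E.
    apply: (lt_le_trans Phis); apply: le_measure; rewrite ?inE//.
    by move=> _ ->; rewrite /= in_itv/= lexx.
  have [//||n ->] := @PhiZ w s 0 `[s, 0%R[%classic; first exact: subset_itv_co_cc.
  by rewrite lte_fin lee_fin ltr0n ler1n.
have BA : B `<=` down A.
  move=> t [t0 Phit].
  have [||||s] := @integer_measure_atom _ (Phi w) t 0 `[t, 0%R[%classic.
  - by move=> C mC Ct; exact: PhiZ Ct.
  - by [].
  - exact: subset_itv_co_cc.
  - by apply: contraTneq Phit => ->; rewrite lee_fin ler10.
  rewrite /= in_itv/= => /andP[ts s0] Phis.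
  by apply/downP; exists s.
(* Without atoms before 0 both sets are empty, and the two suprema take the same default value. *)
have [A0|/set0P A0] := eqVneq A set0.
  suff -> : B = set0 by rewrite A0.
  rewrite -subset0 => t /BA /downP[s]; rewrite A0//.
have hA : has_sup A by split => //; exists 0 => s [/ltW].
have hB : has_sup B by split; [case: A0 => s /AB; exists s|exists 0 => s []].
apply/eqP; rewrite eq_le; apply/andP; split; apply: sup_le => //; last exact: hB.1.
by move=> s /AB Bs; apply/downP; exists s.
Qed.

Lemma measurable_last_before0 : measurable_fun setT (last_before Phi 0).
Proof.
rewrite (_ : last_before Phi 0 = fun w =>
  sup [set t | t <= 0 /\ (1%:E <= Phi w [set` Interval (BLeft t) (BLeft 0%R)])%E]).
  exact: measurable_sup_count.
by apply/funext => w; rewrite last_before0E.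
Qed.

Lemma measurable_point (n : int) : n <= 0 -> measurable_fun setT (point Phi n).
Proof. by rewrite leNgt /point => /negbTE ->; exact: measurable_sup_count. Qed.

(** With unit mass at 0 the point of index 0 is 0 itself; index -1 asks for mass 2 on [[t, 0]], that
    is, for mass 1 on [[t, 0[]. *)
Lemma interarrivalN1 w : Phi w [set 0] = 1%:E ->
  interarrival Phi (-1) w = - last_before Phi 0 w.
Proof.
move=> Phi0; rewrite /interarrival /point/= subr0.
rewrite (_ : sup _ = 0) ?sub0r; last first.
  apply/eqP; rewrite eq_le; apply/andP; split.
    apply: ge_sup; last by move=> t [].
    by exists 0; split => //; rewrite set_itv1 Phi0.
  apply: ub_le_sup; first by exists 0 => t [].
  by split => //; rewrite set_itv1 Phi0.
rewrite last_before0E; congr (- sup _).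
apply/funext => t; apply/propext.
have [t0|t0] := leP t 0; last by split=> -[]; rewrite leNgt t0.
rewrite /= t0.
have -> : Phi w `[t, 0] = (Phi w `[t, 0%R[ + 1)%E.
  rewrite -Phi0 -(@setUitv1 _ _ _ _ true)// measureU//.
  by rewrite -subset0 => s [/= s0 se]; move: s0; rewrite se in_itv/= ltxx andbF.
have [//||n ->] := @PhiZ w t 0 `[t, 0%R[%classic; first exact: subset_itv_co_cc.
rewrite -EFinD !lee_fin (_ : (1 - -1)%:~R = 1 + 1 :> R) ?lerD2r//.
Qed.

End points_before_zero.

Lemma measurable_no_simple_point (R : realType) d (T : measurableType d)
    (Phi : R.-ker T ~> R) : measurable [set w | Phi w [set 0] != 1%E].
Proof.
rewrite (_ : [set w | _] = ~` ((fun w => Phi w [set 0]) @^-1` [set 1%E])).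
  apply: measurableC; rewrite -[X in measurable X]setTI.
  exact: measurable_kernel.
by apply/seteqP; split => w /eqP.
Qed.

(* A window in which no atom has mass 1 has no atom, hence no mass. *)
Lemma palm_simple_point (R : realType) d (T : measurableType d)
    (P : probability T R) (theta : R -> T -> T) (Phi : R.-ker T ~> R) :
  is_flow P theta -> integer_valued Phi -> simple P Phi ->
  stationary theta Phi ->
  palm P theta Phi [set w | Phi w [set 0] != 1%E] = 0%E.
Proof.
move=> flow PhiZ Phi1 PhiS.
have mB := measurable_no_simple_point Phi.
rewrite palmE// (ae_eq_integral (cst 0%E))//; first by rewrite integral0 mule0.
  exact: measurable_palm_window flow PhiZ _ mB.
apply: filterS Phi1 => w Phi1 _; rewrite /palm_window.
apply: contrapT => /eqP window0.
have mW := measurableI _ _ (measurable_flow_preimage flow w mB)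
  (measurable_itv `]0%R, 1%R]%R).
have [x [/= + x01] Phix0] := @integer_measure_atom _ (Phi w) 0 1 _
  (PhiZ w 0 1) mW
  (fun x Wx => subset_itv_oc_cc (proj2 Wx)) window0.
(* Stationarity turns the mass at 0 seen from [theta x w] into the mass of [Phi w] at [x], which is
   a positive integer at most 1. *)
rewrite PhiS// image_set1 add0r; move: (Phi1 x) Phix0.
have [|[|[|n]] ->//] := @PhiZ w x x [set x] (measurable_set1 x).
  by rewrite set_itv1.
- by rewrite ltxx.
- by rewrite eqxx.
- by rewrite lee_fin lern1.
Qed.

Lemma measurable_distr_fun (R : realType) (mu : probability R R) :
  measurable_fun setT (distr_fun mu).
Proof.
apply: nondecreasing_measurable => // x y xy.
by rewrite fine_le ?fin_num_measure// le_measure ?inE//; exact: subset_itvl.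
Qed.

Lemma measurable_inv (R : realType) : measurable_fun setT (@GRing.inv R).
Proof.
rewrite -(setUv [set 0]); apply/measurable_funU => //; first exact: measurableC.
split; first exact: measurable_fun_set1.
apply: open_continuous_measurable_fun => [|x].
  exact/closed_openC/accessible_closed_set1/hausdorff_accessible/Rhausdorff.
by rewrite inE/= => /eqP; exact: inv_continuous.
Qed.

Lemma measurable_hazard (R : realType) (F0 : probability R R) (f0 : R -> R) :
  has_density F0 f0 -> measurable_fun setT (hazard F0 f0).
Proof.
case=> mf0 _ _; apply: measurable_funM => //; apply: measurableT_comp.
  exact: measurable_inv.
by apply: measurable_funB => //; exact: measurable_distr_fun.
Qed.

Lemma hazard_ge0 (R : realType) (F0 : probability R R) (f0 : R -> R) t :
  has_density F0 f0 -> 0 <= hazard F0 f0 t.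
Proof.
case=> _ f00 _; rewrite divr_ge0// subr_ge0 -lee_fin fineK ?fin_num_measure//.
exact: probability_le1.
Qed.

(** The hazard rate is nonnegative, so the lower bound 0 is automatic, and the negative half-line is
    [H]-null: only a sublevel set remains. *)
Lemma hazard_distrE (R : realType) (F0 : probability R R) (f0 : R -> R)
    (H : probability R R) x :
  has_density F0 f0 -> H `]-oo, 0%R[ = 0%E ->
  hazard_distr F0 f0 H x = fine (H [set t | hazard F0 f0 t <= x]).
Proof.
move=> df0 H0; congr fine.
have mh y : measurable [set t | hazard F0 f0 t <= y].
  have := measurable_hazard df0 measurableT (measurable_itv `]-oo, y]%R).
  by rewrite setTI; congr measurable; apply/seteqP; split => t /=; rewrite in_itv.
rewrite (_ : _ `&` _ = [set t | hazard F0 f0 t <= x] `\` `]-oo, 0%R[).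
  rewrite measureD//; last by rewrite (le_lt_trans (probability_le1 _ _))// ltry.
  rewrite [X in (_ - X)%E](_ : _ = 0%E) ?sube0//.
  by apply: (subset_measure0 _ _ _ H0) => //; exact: measurableI.
rewrite setDE setCitvl; congr (_ `&` _); apply/seteqP; split => t /=.
  by rewrite in_itv/= => /andP[].
by rewrite in_itv/= hazard_ge0.
Qed.

(* Palm-almost surely T_0 = 0 is a simple point, so that T_{-1} is the last point
   before 0 and the age at 0 is the inter-arrival time T_0 - T_{-1}. *)
Lemma palm_rate_distr (R : realType) d (T : measurableType d)
    (P : probability T R) (theta : R -> T -> T) (F0 : probability R R)
    (f0 : R -> R) (l : R) (Phi : R.-ker T ~> R) (th : R) :
  F0 `]-oo, 0%R[ = 0%E -> has_density F0 f0 -> is_flow P theta -> 0 < l ->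
  stationary_renewal P theta Phi l (fun t => distr_fun F0 (l * t)) ->
  palm P theta Phi
    [set w | ~ th < l * hazard F0 f0 (l * (0 - last_before Phi 0 w))] =
  (hazard_distr F0 f0 F0 (th / l))%:E.
Proof.
move=> F00 df0 flow l0 [PhiZ Phi1 PhiS Phil [PhiX _]].
have [Q QE] := palm_probability flow PhiZ l0 Phil.
pose X := interarrival Phi (-1); pose Y w := - last_before Phi 0 w.
pose h x := l * hazard F0 f0 (l * x).
have mh : measurable_fun setT h.
  apply: measurable_funM => //; apply: measurableT_comp (measurable_hazard df0) _.
  exact: measurable_funM.
have mX : measurable_fun setT X.
  by apply: measurable_funB; exact: measurable_point.
have mY : measurable_fun setT Y.
  by apply: measurableT_comp => //; exact: measurable_last_before0.
pose B := [set x | h x <= th].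
have mB : measurable B.
  have := mh measurableT _ (measurable_itv `]-oo, th]%R); rewrite setTI.
  by congr measurable; apply/seteqP; split => t /=; rewrite in_itv.
have N0 := palm_simple_point flow PhiZ Phi1 PhiS; rewrite -QE in N0.
have mXB : measurable (X @^-1` B) by rewrite -[X in measurable X]setTI; exact: mX.
have mYB : measurable (Y @^-1` B) by rewrite -[X in measurable X]setTI; exact: mY.
have XYB w : Phi w [set 0] = 1%E -> X w = Y w by exact: interarrivalN1.
have mN := measurable_no_simple_point Phi.
have QXY : Q (X @^-1` B) = Q (Y @^-1` B).
  have QI C : measurable C -> Q C = Q (C `\` [set w | Phi w [set 0] != 1%E]).
    move=> mC; rewrite measureD//; last by rewrite (le_lt_trans (probability_le1 _ _))// ltry.
    rewrite [X in (_ - X)%E](_ : _ = 0%E) ?sube0//.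
    by apply: (subset_measure0 _ _ _ N0) => //; exact: measurableI.
  rewrite QI// [RHS]QI//; congr (Q _); apply/seteqP.
  by split=> w [Bw] /negP/negPn/eqP Phi0; split;
    rewrite /preimage/= ?Phi0 ?eqxx//; move: Bw; rewrite /preimage/= XYB.
rewrite (_ : [set w | _] = Y @^-1` B); last first.
  apply/seteqP; split => w; rewrite /B /h /Y /preimage/= sub0r.
    by move=> /negP; rewrite -leNgt.
  by move=> hw; apply/negP; rewrite -leNgt.
rewrite -QE -QXY hazard_distrE// fineK ?fin_num_measure//; last first.
  have := measurable_hazard df0 measurableT (measurable_itv `]-oo, (th / l)]%R).
  by rewrite setTI; congr measurable; apply/seteqP; split => t /=; rewrite in_itv.
(* [m1] is the Palm law of the inter-arrival time and [m2] the law of [t / l] under [F0]. The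
   renewal hypothesis equates them on half-lines, and [B] need not be a half-line. *)
have [m1 m1E] := pushforward_probability Q mX.
have [|m2 m2E] := @pushforward_probability _ _ _ F0 (fun t => t / l).
  exact: measurable_funM.
rewrite -m1E (@measure_eq_Nyc _ m1 m2)//.
- have lt_ t : l * (t / l) = t by rewrite mulrCA divff ?gt_eqF// mulr1.
  rewrite [LHS](m2E B); congr (F0 _); apply/seteqP; split => t; rewrite /preimage/B/h/=.
    by rewrite lt_ ler_pdivlMr// mulrC.
  by rewrite lt_ ler_pdivlMr// mulrC.
- by move=> x; rewrite (le_lt_trans (probability_le1 _ _))// ltry.
- move=> x; rewrite [LHS](m1E _) [RHS](m2E _).
  have := PhiX (-1) x; rewrite -QE /distr_fun fineK ?fin_num_measure//.
  move=> PhiXx; rewrite [LHS]PhiXx; congr (F0 _); apply/seteqP; split => t /=.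
    by rewrite !in_itv/= ler_pdivrMr// mulrC.
  by rewrite !in_itv/= ler_pdivrMr// mulrC.
Qed.

(** * Weak convergence and truncated means *)

(** A countable set is Lebesgue null and an open interval is not. This supplies continuity points as
    close as desired to any given point. *)
Lemma countable_avoid (R : realType) (D : set R) (a b : R) :
  countable D -> a < b -> exists2 c, a < c < b & ~ D c.
Proof.
move=> cD ab; apply: contrapT => noc.
have abD : `]a, b[ `<=` D.
  move=> c /=; rewrite in_itv/= => acb; apply: contrapT => Dc.
  by apply: noc; exists c.
have := countable_lebesgue_measure0 (sub_countable (subset_card_le abD) cD).
by rewrite lebesgue_measure_itv/= lte_fin ab -EFinB => -[] /eqP; rewrite subr_eq0 gt_eqF.
Qed.

(** By monotonicity one point on each side controls a whole neighbourhood. *)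
Lemma nondecreasing_continuous_at (R : realType) (f : R -> R) (x : R) :
  {homo f : s t / s <= t} ->
  (forall e, 0 < e -> exists2 s, s < x & f x - e < f s) ->
  (forall e, 0 < e -> exists2 t, x < t & f t < f x + e) ->
  {for x, continuous f}.
Proof.
move=> ndf lf rf; apply/cvgrPdist_lt => e e0.
have [s sx fs] := lf _ e0; have [t xt ft] := rf _ e0.
near=> z; have sz : s <= z by apply: ltW; near: z; exact: lt_nbhsr.
have zt : z <= t by apply: ltW; near: z; exact: lt_nbhsl.
rewrite distrC ltr_distl (lt_le_trans fs (ndf _ _ sz))/=.
by rewrite (le_lt_trans (ndf _ _ zt)).
Unshelve. all: by end_near. Qed.

(** Points [s < u < t] outside [D] and close to [u] eventually enclose [u_ n], so [B_ n (u_ n)] lies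
    between [B_ n s] and [B_ n t]. *)
Lemma cvg_nondecreasing_at (R : realType) (B_ : nat -> R -> R) (B : R -> R)
    (D : set R) (u_ : nat -> R) (u : R) :
  countable D -> (forall n, {homo B_ n : s t / s <= t}) ->
  (forall t, ~ D t -> B_ n t @[n --> \oo] --> B t) ->
  {for u, continuous B} -> u_ n @[n --> \oo] --> u ->
  B_ n (u_ n) @[n --> \oo] --> B u.
Proof.
move=> cD ndB BD cB u_u; apply/cvgrPdist_lt => e e0.
have e20 : 0 < e / 2 by rewrite divr_gt0.
move/cvgrPdist_lt : cB => /(_ _ e20) /nbhs_ballP[r /= r0 Br].
have [s /andP[us su] Ds] : exists2 s, u - r < s < u & ~ D s.
  by apply: countable_avoid => //; rewrite ltrBlDr ltrDl.
have [t /andP[ut tu] Dt] : exists2 t, u < t < u + r & ~ D t.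
  by apply: countable_avoid => //; rewrite ltrDl.
have Bs : `|B u - B s| < e / 2.
  by apply: Br; rewrite /ball/= ltr_distl; lra.
have Bt : `|B u - B t| < e / 2.
  by apply: Br; rewrite /ball/= ltr_distl; lra.
have /cvgrPdist_lt /(_ _ e20) BDs := BD _ Ds.
have /cvgrPdist_lt /(_ _ e20) BDt := BD _ Dt.
near=> n.
have sn : s <= u_ n by near: n; move/cvgr_ge : u_u; exact.
have nt : u_ n <= t by near: n; move/cvgr_le : u_u; exact.
have := ndB n _ _ sn; have := ndB n _ _ nt.
have : `|B s - B_ n s| < e / 2 by near: n.
have : `|B t - B_ n t| < e / 2 by near: n.
move: Bs Bt; rewrite !ltr_distl; lra.
Unshelve. all: by end_near. Qed.

(** * Distribution functions, their continuity points and atoms *)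

Section probability_on_reals.
Context {R : realType} (nu : probability R R).

Lemma distr_fun_nd : {homo distr_fun nu : s t / s <= t}.
Proof.
move=> s t st; rewrite fine_le ?fin_num_measure// le_measure ?inE//.
exact: subset_itvl.
Qed.

Lemma distr_funE x : (distr_fun nu x)%:E = nu `]-oo, x].
Proof. by rewrite fineK ?fin_num_measure. Qed.

Lemma distr_fun_right e x : 0 < e ->
  exists2 t, x < t & distr_fun nu t < distr_fun nu x + e.
Proof.
move=> e0.
have : nu `]-oo, x + k.+1%:R^-1] @[k --> \oo] --> nu `]-oo, x].
  rewrite (itvNycEbigcap false).
  apply: (@nonincreasing_cvg_mu _ _ _ nu (fun k => `]-oo, x + k.+1%:R^-1]%classic)) => //.
  - by rewrite (le_lt_trans (probability_le1 _ _))// ltry.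
  - exact: bigcapT_measurable.
  - move=> m n mn; apply/subsetPset; apply: subset_itvl.
    by rewrite bnd_simp lerD2l lef_pV2 ?posrE// ler_nat.
rewrite -distr_funE => /fine_cvg/cvgrPdist_lt/(_ _ e0)[k _ /(_ k (leqnn k))] /=.
rewrite distrC ltr_distl => /andP[_ ke].
by exists (x + k.+1%:R^-1) => //; rewrite ltrDl.
Qed.

(** Without an atom at [x] the mass of []-oo, x]] is that of the increasing union of the []-oo, x -
    1/(k+1)]]. *)
Lemma distr_fun_left e x : nu [set x] = 0%E -> 0 < e ->
  exists2 s, s < x & distr_fun nu x - e < distr_fun nu s.
Proof.
move=> nux e0.
have : nu `]-oo, x - k.+1%:R^-1] @[k --> \oo] --> nu `]-oo, x].
  rewrite -(@setUitv1 _ _ _ _ true)// measureU//; last first.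
    by rewrite -subset0 => s [/= sx se]; move: sx; rewrite se in_itv/= ltxx.
  rewrite [X in (_ + X)%E]nux adde0.
  rewrite (_ : `]-oo, x[%classic = \bigcup_k `]-oo, x - k.+1%:R^-1]%classic); last first.
    apply/seteqP; split=> [t|t [k _]] /=; rewrite !in_itv/=.
      move=> /ltr_add_invr[k xku]; exists k => //=.
      by rewrite in_itv/= lerBrDr ltW.
    by move=> xk; rewrite (le_lt_trans xk)// ltrBlDr ltrDl.
  apply: (@nondecreasing_cvg_mu _ _ _ nu (fun k => `]-oo, x - k.+1%:R^-1]%classic)) => //.
  - exact: bigcupT_measurable.
  - move=> m n mn; apply/subsetPset; apply: subset_itvl.
    by rewrite bnd_simp lerD2l lerN2 lef_pV2 ?posrE// ler_nat.
rewrite -distr_funE => /fine_cvg/cvgrPdist_lt/(_ _ e0)[k _ /(_ k (leqnn k))] /=.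
rewrite distrC ltr_distl => /andP[ke _].
by exists (x - k.+1%:R^-1) => //; rewrite ltrBlDr ltrDl.
Qed.

Lemma distr_fun_continuous x :
  nu [set x] = 0%E -> {for x, continuous (distr_fun nu)}.
Proof.
move=> nux; apply: nondecreasing_continuous_at; first exact: distr_fun_nd.
  by move=> e; exact: distr_fun_left.
by move=> e; exact: distr_fun_right.
Qed.

(** The mass of [x] is the jump between []-oo, x[] and []-oo, x]], which is at most the increment of
    the distribution function from [x - r / 2] to [x]. *)
Lemma continuous_distr_fun x :
  {for x, continuous (distr_fun nu)} -> nu [set x] = 0%E.
Proof.
move=> cx; apply/eqP; rewrite -measure_le0.
have nuE : nu `]-oo, x] = (nu `]-oo, x[ + nu [set x])%E.
  rewrite -(@setUitv1 _ _ _ _ true)// measureU//.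
  by rewrite -subset0 => s [/= sx se]; move: sx; rewrite se in_itv/= ltxx.
rewrite -[leRHS](subee (x := nu `]-oo, x[%classic)) ?fin_num_measure//.
rewrite leeBrDr ?fin_num_measure// addeC -nuE -distr_funE -[leRHS]fineK ?fin_num_measure//.
rewrite lee_fin; apply/ler_addgt0Pr => e e0.
move/cvgrPdist_lt : cx => /(_ _ e0) /nbhs_ballP[r /= r0 Br].
have : `|distr_fun nu x - distr_fun nu (x - r / 2)| < e.
  by apply: Br; rewrite /ball/= ltr_distl; lra.
have : distr_fun nu (x - r / 2) <= fine (nu `]-oo, x[).
  rewrite fine_le ?fin_num_measure// le_measure ?inE//.
  by apply: subset_itvl; rewrite bnd_simp; lra.
rewrite ltr_distl; lra.
Qed.

(** Discontinuity points are atoms, that is, points where the identity, seen as a random variable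
    under [nu], has positive probability. *)
Lemma countable_discontinuities : countable (discontinuities (distr_fun nu)).
Proof.
pose X : {mfun R >-> R} := HB.pack_for {mfun R >-> R} (@idfun R)
  (isMeasurableFun.Build _ _ _ _ (@idfun R) (@measurable_id _ R setT)).
have := pmf_gt0_countable (X : {RV nu >-> R}).
apply: sub_countable; apply: subset_card_le => x /= Dx.
rewrite lt_neqAle fine_ge0// andbT eq_sym; apply/eqP => nux.
apply: Dx; apply: distr_fun_continuous; rewrite -[LHS]fineK ?fin_num_measure//.
by congr EFin.
Qed.

End probability_on_reals.

(** An injection into the natural numbers writes [N] as a countable union of sets with at most one
    point. *)
Lemma countable_null (R : realType) (mu : {measure set R -> \bar R}) (N : set R) :
  countable N -> (forall y, N y -> mu [set y] = 0%E) -> mu.-negligible N.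
Proof.
move=> /countable_injP[f injf] muN.
have -> : N = \bigcup_n (N `&` f @^-1` [set n]).
  by apply/seteqP; split=> [y Ny|y [n _ []]//]; exists (f y).
apply: negligible_bigcup => n.
have [->|/set0P[y [Ny fy]]] := eqVneq (N `&` f @^-1` [set n]) set0.
  exact: negligible_set0.
exists [set y]; split => //; first exact: muN.
by move=> z [Nz /= fz]; apply: injf; rewrite ?inE//= fz fy.
Qed.

(** * The truncated mean as a function of the truncation level *)

Section truncated_mean.
Context {R : realType} (nu : probability R R).

(** The function A of the layer-cake argument, for a general law; [trunc_meanE] shows that [fine]
    loses nothing. *)
Definition trunc_mean (u : R) : R := fine (\int[nu]_(l in `]0%R, u]) l%:E)%E.

Lemma distr_fun_itv s t : s <= t ->
  nu `]s, t] = (distr_fun nu t - distr_fun nu s)%:E.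
Proof.
move=> st; rewrite EFinB !distr_funE.
rewrite (_ : `]s, t] = `]-oo, t] `\` `]-oo, s])%classic; last first.
  by rewrite -[RHS]setCK setCD setCitvl setUC -[LHS]setCK setCitv.
rewrite measureD//; last by rewrite (le_lt_trans (probability_le1 _ _))// ltry.
by rewrite setIidr//; exact: subset_itvl.
Qed.

(* Layer cake: the truncated mean depends on nu through its distribution function
   only. *)
Lemma trunc_mean_ccdf (u : R) : (\int[nu]_(l in `]0%R, u]) l%:E =
  \int[lebesgue_measure]_(r in `[0%R, +oo[)
    (Num.max 0 (distr_fun nu u - distr_fun nu r))%R%:E)%E.
Proof.
pose f (l : R) : R := l * \1_(`]0%R, u]) l.
have f0 l : 0 <= f l.
  rewrite /f indicE; case: (boolP (l \in _)); last by rewrite mulr0.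
  by rewrite inE/= in_itv/= mulr1 => /andP[/ltW].
have mf : measurable_fun setT f by apply: measurable_funM.
pose X : {mfun R >-> R} := HB.pack_for {mfun R >-> R} f
  (isMeasurableFun.Build _ _ _ _ f mf).
have := @ge0_expectation_ccdf _ _ _ nu X f0.
rewrite expectation_def => XE; rewrite integral_mkcond.
transitivity (\int[nu]_l (X l)%:E)%E.
  apply: eq_integral => l _; rewrite patchE /= /f indicE.
  by case: ifP; rewrite ?mulr1 ?mulr0.
rewrite XE; apply: eq_integral => r; rewrite inE/= in_itv/= andbT => r0.
rewrite /ccdf /distribution /pushforward.
(* Since [0 <= r], the points where [f] vanishes do not count. The interval is empty for [u < r],
   which accounts for the maximum with 0. *)
have -> : X @^-1` `]r, +oo[ = `]r, u]%classic.
  apply/seteqP; split=> l; rewrite /preimage/= !in_itv/= andbT /f indicE.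
    case: (boolP (l \in _)); rewrite ?mulr0 ?ltNge ?r0// mulr1.
    by rewrite inE/= in_itv/= => /andP[_ ->]; rewrite -ltNge => ->.
  by move=> /andP[rl lu]; rewrite mem_set ?mulr1//= in_itv/= lu (le_lt_trans r0).
have [ru|ur] := leP r u.
  by rewrite distr_fun_itv// max_r// subr_ge0 distr_fun_nd.
rewrite set_itv_ge ?measure0 ?bnd_simp -?leNgt ?ltW// max_l//.
by rewrite subr_le0 distr_fun_nd// ltW.
Qed.

(** The absolute value covers [u < 0], where the domain is empty. *)
Lemma trunc_mean_bound (u : R) : (\int[nu]_(l in `]0%R, u]) l%:E <= `|u|%:E)%E.
Proof.
apply: (@le_trans _ _ (\int[nu]_(l in `]0%R, u]) `|u|%:E)%E).
  apply: ge0_le_integral => //.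
  - by move=> l /=; rewrite in_itv/= lee_fin => /andP[/ltW].
  - move=> l /=; rewrite in_itv/= lee_fin => /andP[l0 lu].
    by rewrite (le_trans lu)// ler_norm.
rewrite integral_cst// -[leRHS]mule1 lee_pmul//.
exact: probability_le1.
Qed.

Lemma trunc_mean_ge0 u : (0 <= \int[nu]_(l in `]0%R, u]) l%:E)%E.
Proof. by apply: integral_ge0 => l /=; rewrite in_itv/= lee_fin => /andP[/ltW]. Qed.

Lemma trunc_meanE u : (trunc_mean u)%:E = (\int[nu]_(l in `]0%R, u]) l%:E)%E.
Proof.
rewrite fineK// ge0_fin_numE ?trunc_mean_ge0//.
by rewrite (le_lt_trans (trunc_mean_bound u))// ltry.
Qed.

Lemma trunc_mean_nd : {homo trunc_mean : s t / s <= t}.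
Proof.
move=> s t st; rewrite -lee_fin !trunc_meanE; apply: ge0_subset_integral => //.
  by move=> l /=; rewrite in_itv/= lee_fin => /andP[/ltW].
by apply: subset_itvl; rewrite bnd_simp.
Qed.

(** The increment integrates [l] over the positive part of []s, t]], where [l] is at most [|t|].
    Continuity of the distribution function is transferred through this bound. *)
Lemma trunc_mean_increment s t : s <= t ->
  trunc_mean t - trunc_mean s <= `|t| * (distr_fun nu t - distr_fun nu s).
Proof.
move=> st; rewrite lerBlDl -lee_fin EFinD EFinM !trunc_meanE -distr_fun_itv//.
rewrite -integral_cst// [leLHS]integral_mkcond [X in (_ <= X + _)%E]integral_mkcond.
rewrite [X in (_ <= _ + X)%E]integral_mkcond.
have mid (A : set R) : measurable A -> measurable_fun setT ((EFin \o (@idfun R)) \_ A).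
  by move=> mA; apply/(measurable_restrictT _ mA); exact/measurable_EFinP/measurable_id.
have mt : measurable_fun setT ((cst `|t|%:E) \_ `]s, t]).
  by apply/(measurable_restrictT _ (measurable_itv _)).
have id0 u l : (0 <= ((EFin \o (@idfun R)) \_ `]0%R, u]) l)%E.
  by rewrite erestrict_ge0// => x /=; rewrite in_itv/= lee_fin => /andP[/ltW].
have t0 l : (0 <= ((cst `|t|%:E) \_ `]s, t]) l)%E.
  by rewrite erestrict_ge0// => x _; rewrite lee_fin.
rewrite -ge0_integralD//; last exact: mid.
apply: ge0_le_integral => //; first exact: mid.
  by apply: emeasurable_funD => //; exact: mid.
(* Outside its set a restricted function takes the default point of [\bar R], which is 0. *)
have pE : classical_sets.point = 0%E :> \bar R by [].
move=> l _; rewrite !patchE !mem_setE !in_itv/= !pE.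
case: (ltP 0 l) => [l0|l0] /=; last first.
  by rewrite add0e; case: ifP.
case: (leP l t) => [lt|tl]/=; last first.
  by rewrite andbF adde0; case: ifP => // _; rewrite lee_fin ltW.
rewrite andbT; case: (leP l s) => [ls|sl]/=; first by rewrite adde0.
by rewrite add0e lee_fin (le_trans lt)// ler_norm.
Qed.

Lemma trunc_mean_continuous u :
  {for u, continuous (distr_fun nu)} -> {for u, continuous trunc_mean}.
Proof.
move=> cu; apply: nondecreasing_continuous_at; first exact: trunc_mean_nd.
- move=> e e0; have e1 : 0 < e / (`|u| + 1) by rewrite divr_gt0// ltr_wpDl.
  have [s su Fs] := distr_fun_left (continuous_distr_fun cu) e1.
  exists s => //; have := trunc_mean_increment (ltW su).
  move=> h; rewrite ltrBlDl -ltrBlDr (le_lt_trans h)//.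
  have : `|u| * (distr_fun nu u - distr_fun nu s) <= (`|u| + 1) * (distr_fun nu u - distr_fun nu s).
    by rewrite ler_wpM2r ?lerDl// subr_ge0 distr_fun_nd// ltW.
  move/le_lt_trans; apply; rewrite mulrC -ltr_pdivlMr ?ltr_wpDl//; lra.
- move=> e e0; have e1 : 0 < e / (`|u| + 1) by rewrite divr_gt0// ltr_wpDl.
  have [t ut Ft] := @distr_fun_right _ nu _ u e1.
  (* Capping at [u + 1] keeps the factor [|t'|] below [|u| + 1], the constant by which [e] was
     divided. *)
  pose t' := Num.min t (u + 1).
  have ut' : u < t' by rewrite lt_min ut ltrDl ltr01.
  have Ft' : distr_fun nu t' < distr_fun nu u + e / (`|u| + 1).
    by apply: le_lt_trans Ft; rewrite distr_fun_nd// ge_min lexx.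
  exists t' => //; have := trunc_mean_increment (ltW ut').
  move=> h; rewrite -ltrBlDl (le_lt_trans h)//.
  have : `|t'| * (distr_fun nu t' - distr_fun nu u) <=
      (`|u| + 1) * (distr_fun nu t' - distr_fun nu u).
    rewrite ler_wpM2r ?subr_ge0 ?distr_fun_nd ?(ltW ut')//.
    have : t' <= u + 1 by rewrite ge_min lexx orbT.
    move: ut'; rewrite ler_norml; have := ler_norm u; have := ler_norm (- u); rewrite normrN; lra.
  move/le_lt_trans; apply; rewrite mulrC -ltr_pdivlMr ?ltr_wpDl//; lra.
Qed.

End truncated_mean.

Lemma dominated_cvgR d (T : measurableType d) (R : realType)
    (mu : {measure set T -> \bar R}) (D : set T) (f_ : nat -> T -> R)
    (f g : T -> R) :
  measurable D -> (forall n, measurable_fun D (f_ n)) -> measurable_fun D f ->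
  {ae mu, forall x, D x -> f_ n x @[n --> \oo] --> f x} ->
  mu.-integrable D (EFin \o g) -> (forall n x, D x -> `|f_ n x| <= g x) ->
  (\int[mu]_(x in D) (f_ n x)%:E)%E @[n --> \oo] --> (\int[mu]_(x in D) (f x)%:E)%E.
Proof.
move=> mD mf_ mf ff ig fg.
have [|||||_ _] := @dominated_convergence _ _ _ mu D mD (fun n x => (f_ n x)%:E)
  (fun x => (f x)%:E) (EFin \o g) => //.
- by move=> n; exact/measurable_EFinP.
- exact/measurable_EFinP.
- apply: filterS ff => x fx Dx; apply: cvg_EFin; first exact: nearW.
  exact: fx.
- by apply: aeW => x n Dx; rewrite lee_fin fg.
Qed.

Lemma cvg_max0 (R : realType) (a_ : nat -> R) (a : R) :
  a_ n @[n --> \oo] --> a -> Num.max 0 (a_ n) @[n --> \oo] --> Num.max 0 a.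
Proof.
move=> aa; rewrite maxr_absE.
under eq_fun do rewrite maxr_absE.
apply: cvgMl; apply: cvgD; first by apply: cvgD => //; exact: cvg_cst.
by apply: cvg_norm; apply: cvgB => //; exact: cvg_cst.
Qed.

(** * Convergence of truncated means and of means *)

Section mean_convergence.
Context {R : realType} (nu_ : nat -> probability R R) (nu : probability R R).
Let D := discontinuities (distr_fun nu).
Hypothesis cvgF : forall t, ~ D t ->
  distr_fun (nu_ n) t @[n --> \oo] --> distr_fun nu t.

(** Dominated convergence in the layer-cake formula: the integrands converge outside the countable,
    hence Lebesgue null, set [D], and are bounded by the indicator of [[0, u]]. *)
Lemma cvg_trunc_mean u : ~ D u ->
  trunc_mean (nu_ n) u @[n --> \oo] --> trunc_mean nu u.
Proof.
move=> Du.
pose f (m : probability R R) r : R := Num.max 0 (distr_fun m u - distr_fun m r).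
have fE m : trunc_mean m u = fine (\int[lebesgue_measure]_(r in `[0%R, +oo[) (f m r)%:E)%E.
  by rewrite /trunc_mean trunc_mean_ccdf.
suff : (\int[lebesgue_measure]_(r in `[0%R, +oo[) (f (nu_ n) r)%:E)%E @[n --> \oo] -->
       (trunc_mean nu u)%:E.
  move=> /fine_cvg; apply: cvg_trans; apply: near_eq_cvg; apply: nearW => n.
  by rewrite /= fE.
rewrite trunc_meanE trunc_mean_ccdf.
have mf (m : probability R R) : measurable_fun setT (f m).
  apply: nonincreasing_measurable => // r s rs.
  by rewrite /f ge_max le_max lexx/= le_max lerB ?orbT// distr_fun_nd.
apply: (@dominated_cvgR _ _ R lebesgue_measure `[0%R, +oo[%classic
  (fun n => f (nu_ n)) (f nu) (\1_(`[0%R, u]))) => //.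
- by move=> n; exact: measurable_funTS (mf _).
- exact: measurable_funTS (mf _).
- have cD : countable D by exact: countable_discontinuities.
  exists D; split; [exact: countable_measurable|exact: countable_lebesgue_measure0|].
  move=> r /= /not_implyP[r0 nr]; apply: contrapT => Dr; apply: nr.
  by apply: cvg_max0; apply: cvgB; exact: cvgF.
- exact: (integrableS measurableT _ _ (integrable_indic_itv _ _ _ _)).
- move=> n r /=; rewrite in_itv/= andbT => r0.
  rewrite indicE ger0_norm ?/f ?le_max ?lexx//.
  have [ru|ur] := leP r u.
    rewrite mem_set/=; last by rewrite in_itv/= r0.
    rewrite ge_max ler01 lerBlDr -lee_fin EFinD distr_funE.
    apply: le_trans (probability_le1 _ _) _ => //.
    by rewrite leeDl// lee_fin fine_ge0.
  rewrite memNset/=; last by rewrite in_itv/= [r <= u]leNgt ur andbF.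
  by rewrite max_l// subr_le0 distr_fun_nd// ltW.
Qed.

Hypothesis ui : forall e : R, 0 < e -> exists2 K : R, 0 <= K & forall n,
  (\int[nu_ n]_(l in `]0%R, +oo[) (l * (K <= l)%R%:R)%:E <= e%:E)%E.

(** As [fine] sends an infinite integral to 0, this is the mean only once finiteness is known, as in
    [mean_finite] and [limit_mean_finite]. *)
Definition mean (m : probability R R) : R :=
  fine (\int[m]_(l in `]0%R, +oo[) l%:E)%E.

(** Beyond [u >= K] the indicator in [ui] equals 1, so the tail left out by the truncation is at
    most [e], uniformly in [n]. *)
Lemma mean_tail e : 0 < e -> exists2 K : R, 0 <= K & forall u n, K <= u ->
  (\int[nu_ n]_(l in `]0%R, +oo[) l%:E <= (trunc_mean (nu_ n) u + e)%:E)%E.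
Proof.
move=> e0; have [K K0 uiK] := ui e0; exists K => // u n Ku.
have u0 : 0 <= u by exact: le_trans Ku.
have E : `]0, +oo[%classic = `]0, u] `|` `]u, +oo[%classic :> set R.
  by rewrite -itv_bndbnd_setU.
have mK (A : set R) : measurable_fun A (fun l : R => (l * (K <= l)%R%:R)%:E).
  apply/measurable_EFinP; apply: measurable_funTS; apply: measurable_funM => //.
  apply: nondecreasing_measurable => // x y xy; rewrite ler_nat.
  by case: (leP K x) => // Kx; rewrite (le_trans Kx).
rewrite E ge0_integral_setU//=.
- rewrite EFinD trunc_meanE leeD2l//.
  apply: le_trans (uiK n).
  apply: (@le_trans _ _ (\int[nu_ n]_(l in `]u, +oo[) (l * (K <= l)%R%:R)%:E)%E).
    apply: ge0_le_integral => //.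
    + by move=> l /=; rewrite in_itv/= andbT lee_fin => /ltW; exact: le_trans.
    + move=> l /=; rewrite in_itv/= andbT => ul.
      by rewrite (le_trans Ku (ltW ul)) mulr1.
  apply: ge0_subset_integral => //.
  + by move=> l /=; rewrite in_itv/= andbT lee_fin => l0; rewrite mulr_ge0// ltW.
  + by apply: subset_itvr; rewrite bnd_simp.
- move=> l; rewrite !in_itv/= andbT lee_fin => -[/andP[/ltW//]|/ltW ul].
  exact: le_trans ul.
- by apply/disj_setPS => l /=; rewrite !in_itv/= andbT => -[/andP[_ lu]]; rewrite ltNge lu.
Qed.

Lemma mean_bounded : exists M : R, forall n,
  (\int[nu_ n]_(l in `]0%R, +oo[) l%:E <= M%:E)%E.
Proof.
have [K K0 meanK] := mean_tail ltr01; exists (`|K| + 1) => n.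
apply: le_trans (meanK K n (lexx _)) _.
by rewrite lee_fin lerD2r -lee_fin trunc_meanE trunc_mean_bound.
Qed.

Lemma trunc_mean_le_mean (m : probability R R) u :
  ((trunc_mean m u)%:E <= \int[m]_(l in `]0%R, +oo[) l%:E)%E.
Proof.
rewrite trunc_meanE; apply: ge0_subset_integral => //.
  by move=> l /=; rewrite in_itv/= andbT lee_fin => /ltW.
exact: subset_itvl.
Qed.

(** The bound passes to the limit in [n] between truncation levels that are continuity points;
    monotone convergence then lets the upper level tend to infinity. *)
Lemma limit_mean_tail e : 0 < e -> exists2 K : R, 0 <= K & forall u, K <= u ->
  ~ D u -> (\int[nu]_(l in `]0%R, +oo[) l%:E <= (trunc_mean nu u + e)%:E)%E.
Proof.
move=> e0; have [K K0 meanK] := mean_tail e0; exists K => // u Ku Du.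
have nuv v : trunc_mean nu v <= trunc_mean nu u + e.
  have [v' /andP[vv' _] Dv'] : exists2 c, v < c < v + 1 & ~ D c.
    by apply: countable_avoid; [exact: countable_discontinuities|rewrite ltrDl].
  apply: le_trans (trunc_mean_nd nu (ltW vv')) _.
  apply: ler_cvg_to (cvg_trunc_mean Dv') (cvgD (cvg_trunc_mean Du) (cvg_cst e)) _.
  apply: nearW => n; rewrite -lee_fin; apply: le_trans (meanK u n Ku).
  exact: trunc_mean_le_mean.
have : (\int[nu]_(l in `]0%R, k%:R]) l%:E)%E @[k --> \oo] -->
    (\int[nu]_(l in `]0%R, +oo[) l%:E)%E.
  rewrite itvbndyEbigcup.
  rewrite (_ : \bigcup_k _ = \bigcup_k `]0%R, k%:R]%classic :> set R); last first.
    apply/seteqP; split=> l [k _]/=; rewrite in_itv/= => /andP[l0 lk].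
      by exists k => //=; rewrite in_itv/= l0 ltW.
    by exists k.+1 => //=; rewrite in_itv/= l0 (le_lt_trans lk)// ltr_nat.
  apply: ge0_nondecreasing_set_cvg_integral => //.
    by move=> k m km; apply/subsetPset; apply: subset_itvl; rewrite bnd_simp ler_nat.
  by move=> k l /=; rewrite in_itv/= lee_fin => /andP[/ltW].
move=> cvgm; rewrite -(cvg_lim _ cvgm)//; apply: lime_le.
  by apply/cvg_ex; eexists; exact: cvgm.
by apply: nearW => k; rewrite -trunc_meanE lee_fin nuv.
Qed.

Lemma meanE (m : probability R R) (M : R) :
  (\int[m]_(l in `]0%R, +oo[) l%:E <= M%:E)%E ->
  (mean m)%:E = (\int[m]_(l in `]0%R, +oo[) l%:E)%E.
Proof.
move=> mM; rewrite fineK// ge0_fin_numE ?(le_lt_trans mM) ?ltry//.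
by apply: integral_ge0 => l /=; rewrite in_itv/= andbT lee_fin => /ltW.
Qed.

Lemma limit_mean_finite :
  (mean nu)%:E = (\int[nu]_(l in `]0%R, +oo[) l%:E)%E.
Proof.
have [K K0 meanK] := limit_mean_tail ltr01.
have [c /andP[Kc _] Dc] : exists2 c, K < c < K + 1 & ~ D c.
  by apply: countable_avoid; [exact: countable_discontinuities|rewrite ltrDl].
exact: meanE (meanK _ (ltW Kc) Dc).
Qed.

Lemma mean_finite n :
  (mean (nu_ n))%:E = (\int[nu_ n]_(l in `]0%R, +oo[) l%:E)%E.
Proof. by have [M meanM] := mean_bounded; exact: meanE (meanM n). Qed.

Lemma cvg_mean : mean (nu_ n) @[n --> \oo] --> mean nu.
Proof.
apply/cvgrPdist_lt => e e0; have e20 : 0 < e / 2 by rewrite divr_gt0.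
have [K K0 meanK] := mean_tail e20.
have [K' K'0 meanK'] := limit_mean_tail e20.
have [c /andP[Kc _] Dc] : exists2 c, Num.max K K' < c < Num.max K K' + 1 & ~ D c.
  by apply: countable_avoid; [exact: countable_discontinuities|rewrite ltrDl].
move: Kc; rewrite gt_max => /andP[/ltW Kc /ltW K'c].
have := meanK' _ K'c Dc; have := trunc_mean_le_mean nu c.
rewrite -limit_mean_finite !lee_fin => mean1 mean2.
have /cvgrPdist_lt/(_ _ e20) := cvg_trunc_mean Dc.
(* Both truncation errors lie between 0 and [e / 2], so their difference costs one half of [e] and
   the truncated means the other. *)
apply: filterS => n; have := meanK c n Kc; have := trunc_mean_le_mean (nu_ n) c.
rewrite -mean_finite !lee_fin !ltr_distl; lra.
Qed.

End mean_convergence.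

(** * Products with an independent factor *)

(* For y <= 0 the constraint l * y <= x is void since 0 <= x; this also accounts
   for an atom of mu at 0. *)
Lemma mixing_tonelli (R : realType) (nu mu : probability R R) (w : R -> R) (x : R) :
  measurable_fun setT w -> (forall l, 0 < l -> 0 <= w l) -> 0 <= x ->
  (\int[nu]_(l in `]0%R, +oo[) (w l * distr_fun mu (x / l))%:E =
   \int[mu]_y (if (0 < y)%R then \int[nu]_(l in `]0%R, (x / y)%R]) (w l)%:E
               else \int[nu]_(l in `]0%R, +oo[) (w l)%:E))%E.
Proof.
move=> mw w0 x0.
pose E : set (R * R) := [set p | p.1 * p.2 <= x].
pose f (p : R * R) : \bar R :=
  (w p.1 * \1_(`]0%R, +oo[%classic : set R) p.1 * \1_E p)%:E.
have mE : measurable E.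
  have := @measurable_funM _ _ _ setT (@fst R R) (@snd R R).
  move=> /(_ measurable_fst measurable_snd measurableT _ (measurable_itv `]-oo, x]%R)).
  by rewrite setTI; congr measurable; apply/seteqP; split => p /=; rewrite in_itv.
have mf : measurable_fun setT f.
  apply/measurable_EFinP; apply: measurable_funM => //; apply: measurable_funM.
    exact: measurableT_comp mw measurable_fst.
  by apply: (measurableT_comp _ measurable_fst).
have f0 p : (0 <= f p)%E.
  rewrite lee_fin mulr_ge0// indicE; case: (boolP (p.1 \in _)); rewrite ?mulr0// mulr1.
  by rewrite inE/= in_itv/= andbT; exact: w0.
transitivity (\int[nu]_l \int[mu]_y f (l, y))%E.
  rewrite integral_mkcond; apply: eq_integral => l _; rewrite patchE.
  case: ifPn => l0; last first.
    rewrite integral0_eq// => y _.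
    by rewrite /f/= indicE (negbTE l0) mulr0 mul0r.
  have l0' : 0 < l by move: l0; rewrite inE/= in_itv/= andbT.
  rewrite /f/=; under eq_integral do rewrite indicE l0 mulr1 EFinM.
  rewrite ge0_integralZl_EFin//; last exact: w0.
    rewrite EFinM distr_funE; congr (_ * _)%E.
    rewrite (_ : (fun y => (\1_E (l, y))%:E) =
        (fun y => (\1_(`]-oo, (x / l)%R]%classic : set R) y)%:E)).
      by rewrite integral_indic// setIT.
    apply/funext => y; rewrite !indicE; congr ((nat_of_bool _)%:R%:E); apply/idP/idP.
      by rewrite !inE/E/= in_itv/= ler_pdivlMr// mulrC.
    by rewrite !inE/E/= in_itv/= ler_pdivlMr// mulrC.
  apply/measurable_EFinP.
  have m1E : measurable_fun setT (\1_E : R * R -> R) by exact: measurable_indic.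
  exact: (measurableT_comp m1E (pair1_measurable l)).
rewrite (fubini_tonelli f)//; apply: eq_integral => y _.
have Eb p : (p \in E) = (p.1 * p.2 <= x) by apply/idP/idP; rewrite inE.
have pE : classical_sets.point = 0%E :> \bar R by [].
case: ifPn => y0; rewrite [RHS]integral_mkcond; apply: eq_integral => l _;
  rewrite patchE /f !indicE Eb !mem_setE !in_itv/= andbT pE.
  rewrite -ler_pdivlMr//; case: (0 < l) => /=; rewrite ?mulr0 ?mul0r//.
  by rewrite mulr1; case: ifP; rewrite ?mulr1 ?mulr0.
have [l0|l0] := ltP 0 l; last by rewrite mulr0 mul0r.
rewrite (_ : l * y <= x) ?mulr1// (le_trans _ x0)//.
by rewrite pmulr_rle0// leNgt.
Qed.

Lemma measurable_mixing (R : realType) (B : R -> R) (x t : R) :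
  {homo B : s u / s <= u} ->
  measurable_fun setT (fun y : R => if 0 < y then B (x / y) else t).
Proof.
move=> ndB; apply: measurable_fun_ifT => //; first exact: measurable_fun_ltr.
apply: measurableT_comp; first exact: nondecreasing_measurable.
by apply: measurable_funM => //; exact: measurable_inv.
Qed.

(** Used twice: with distribution functions and total 1, and with truncated means and the mean as
    total. [tot] is the value for [y <= 0], where the constraint on [l] is void. For [y > 0]
    convergence can fail only if [x / y] is in [D], which the last hypothesis makes [mu]-null. *)
Lemma cvg_mixing (R : realType) (mu : probability R R) (B_ : nat -> R -> R)
    (B : R -> R) (tot_ : nat -> R) (tot M : R) (D : set R) (x_ : nat -> R) (x : R) :
  countable D -> ~ D 0 ->
  (forall n, {homo B_ n : s t / s <= t}) -> {homo B : s t / s <= t} ->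
  (forall n t, 0 <= B_ n t <= M) -> (forall n, 0 <= tot_ n <= M) ->
  tot_ n @[n --> \oo] --> tot ->
  (forall t, ~ D t -> B_ n t @[n --> \oo] --> B t) ->
  (forall t, ~ D t -> {for t, continuous B}) ->
  x_ n @[n --> \oo] --> x ->
  (forall t y, D t -> mu [set y] != 0%E -> x <> t * y) ->
  (\int[mu]_y (if 0 < y then B_ n (x_ n / y) else tot_ n)%:E)%E @[n --> \oo] -->
  (\int[mu]_y (if 0 < y then B (x / y) else tot)%:E)%E.
Proof.
move=> cD D0 ndB_ ndB B_M tot_M tott BD cB xx xD.
pose N := [set y | 0 < y /\ D (x / y)].
have nN : mu.-negligible N.
  apply: countable_null.
    apply: (@sub_countable _ _ _ ((fun t => x / t) @` D)).
      apply: subset_card_le => y [y0 Dxy]; exists (x / y) => //.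
      (* Since [D] omits 0, [x] is nonzero, so [y] is recovered from [x / y]. *)
      have x0 : x != 0 by apply: contra_notN D0 => /eqP x0; move: Dxy; rewrite x0 mul0r.
      by rewrite invf_div mulrC divfK.
    exact: card_le_trans (card_image_le _ _) cD.
  move=> y [y0 Dxy]; apply: contrapT => /eqP muy.
  by apply: (xD _ _ Dxy muy); rewrite divfK// gt_eqF.
apply: (@dominated_cvgR _ _ _ mu setT
  (fun n y => if 0 < y then B_ n (x_ n / y) else tot_ n)
  (fun y => if 0 < y then B (x / y) else tot) (cst M)) => //.
- by move=> n; exact: measurable_mixing.
- exact: measurable_mixing.
- have [A [mA muA NA]] := nN; exists A; split => //; apply: subset_trans NA.
  move=> y /= /not_implyP[_ ny]; apply: contrapT => nNy; apply: ny.
  case: ifPn => y0 //.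
  have Dxy : ~ D (x / y) by move=> Dxy; apply: nNy.
  apply: (cvg_nondecreasing_at cD) => //; first exact: cB.
  by apply: cvgMl.
- exact: finite_measure_integrable_cst.
- move=> n y _; have /andP[tot0 totM] := tot_M n.
  case: ifPn => _; last by rewrite ger0_norm.
  by have /andP[Bn0 BnM] := B_M n (x_ n / y); rewrite ger0_norm.
Qed.

(** [th_ n] is enclosed between points outside [E]. Continuity of [Q] at [p] yields a level [q]
    strictly between [G x] and [p] when [x < Q p], and a level [q > p] already reached by [G x] when
    [x > Q p]; [G_ n x] and [p_ n] are then eventually ordered the same way. *)
Lemma cvg_quantile (R : realType) (G_ : nat -> R -> R) (G : R -> R)
    (p_ th_ : nat -> R) (p : R) (E : set R) :
  let Q q := inf [set x | 0 <= x /\ q <= G x] in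
  countable E ->
  (forall n x y, 0 <= x -> x <= y -> G_ n x <= G_ n y) ->
  (forall x y, 0 <= x -> x <= y -> G x <= G y) ->
  0 <= G 0 -> (forall q, q < 1 -> exists2 x, 0 <= x & q <= G x) ->
  (forall x, 0 <= x -> ~ E x -> G_ n x @[n --> \oo] --> G x) ->
  (forall n, 0 <= th_ n) -> (forall n, G_ n (th_ n) = p_ n) ->
  p_ n @[n --> \oo] --> p -> 0 <= p < 1 ->
  Q q @[q --> within `[0%R, 1%R] (nbhs p)] --> Q p ->
  th_ n @[n --> \oo] --> Q p.
Proof.
move=> Q cE ndG_ ndG G0 G1 GE th0 Gth pp /andP[p0 p1] cQ.
have hl q : has_lbound [set x | 0 <= x /\ q <= G x] by exists 0 => x [].
have lo x : x < Q p -> ~ E x -> \forall n \near \oo, x <= th_ n.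
  move=> xQ Ex; have [x0|x0] := ltP x 0.
    by apply: nearW => n; rewrite (le_trans (ltW x0)).
  (* At [p = 0] the quantile is at most 0 because [0 <= G 0], which leaves no room for
     [0 <= x < Q p]. *)
  have pgt0 : 0 < p.
    rewrite lt_neqAle p0 andbT; apply/eqP => pE; move: xQ; rewrite ltNge => /negP; apply.
    apply: le_trans x0; apply: ge_inf (hl _) _ _.
    by split => //; rewrite -pE.
  have [q [q0 qp Gxq]] : exists q, [/\ 0 <= q, q < p & G x < q].
    move/cvgrPdist_lt : cQ => /(_ (Q p - x)); rewrite subr_gt0 => /(_ xQ).
    rewrite near_withinE => /nbhs_ballP[r /= r0 Qr].
    (* The maximum keeps [q] in [[0, 1]], where the continuity of [Q] is available. *)
    pose q := Num.max 0 (p - r / 2).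
    have q0 : 0 <= q by rewrite le_max lexx.
    have qp : q < p by rewrite gt_max pgt0/=; lra.
    have pq : p - r / 2 <= q by rewrite le_max lexx orbT.
    exists q; split => //; rewrite ltNge; apply/negP => qG.
    have := Qr q; rewrite /ball/= ltr_distl in_itv/=.
    have Qx : Q q <= x by apply: ge_inf (hl _) _ _.
    move=> /(_ _ _)/wrap[]; first lra.
      by rewrite q0/=; lra.
    rewrite ltr_distl; lra.
  have /cvgrPdist_lt/(_ _ (_ : 0 < (q - G x))) := GE x x0 Ex.
  rewrite subr_gt0 => /(_ Gxq); move/cvgr_ge : pp => /(_ _ qp).
  apply: filterS2 => n qpn Gn; rewrite leNgt; apply/negP => thx.
  have := ndG_ n _ _ (th0 n) (ltW thx).
  rewrite Gth; move: Gn; rewrite ltr_distl; lra.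
have up x : Q p < x -> ~ E x -> \forall n \near \oo, th_ n <= x.
  move=> Qx Ex.
  have [q [pq Qqx q1]] : exists q, [/\ p < q, Q q < x & q < 1].
    move/cvgrPdist_lt : cQ => /(_ (x - Q p)); rewrite subr_gt0 => /(_ Qx).
    rewrite near_withinE => /nbhs_ballP[r /= r0 Qr].
    (* The cap [(p + 1) / 2] keeps [q < 1], so that level [q] is attained and the infimum is over a
       nonempty set. *)
    pose q := Num.min ((p + 1) / 2) (p + r / 2).
    have pq : p < q by rewrite lt_min; apply/andP; split; lra.
    have q1 : q <= (p + 1) / 2 by rewrite ge_min lexx.
    have qr : q <= p + r / 2 by rewrite ge_min lexx orbT.
    exists q; split => //; last by lra.
    have : `|Q p - Q q| < x - Q p.
      apply: Qr; first by rewrite /ball/= ltr_distl; lra.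
      by rewrite /= in_itv/=; lra.
    rewrite ltr_distl; lra.
  have [y [y0 qy] yx] : exists2 y, 0 <= y /\ q <= G y & y < x.
    by apply: inf_lt Qqx; have [y y0 qy] := G1 _ q1; exists y.
  have x0 : 0 <= x by rewrite (le_trans y0)// ltW.
  have qGx : q <= G x by rewrite (le_trans qy)// ndG// ltW.
  (* The midpoint of [p] and [q] eventually separates [p_ n] from [G_ n x]. *)
  have := GE x x0 Ex; move=> /cvgr_gt/(_ ((p + q) / 2))/(_ _)/wrap[]; first lra.
  have /cvgr_lt/(_ ((p + q) / 2)) := pp; move=> /(_ _)/wrap[]; first lra.
  apply: filterS2 => n pn Gn; rewrite leNgt; apply/negP => thx.
  have := ndG_ n _ _ x0 (ltW thx).
  rewrite Gth; lra.
apply/cvgrPdist_lt => e e0.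
have [a /andP[ea aQ] Ea] : exists2 a, Q p - e < a < Q p & ~ E a.
  by apply: countable_avoid => //; rewrite ltrBlDr ltrDl.
have [b /andP[Qb be] Eb] : exists2 b, Q p < b < Q p + e & ~ E b.
  by apply: countable_avoid => //; rewrite ltrDl.
apply: filterS2 (lo _ aQ Ea) (up _ Qb Eb) => n an nb.
rewrite ltr_distl; lra.
Qed.

Lemma distr_fun_ge0 (R : realType) (mu : probability R R) x : 0 <= distr_fun mu x.
Proof. exact: fine_ge0. Qed.

Lemma distr_fun_le1 (R : realType) (mu : probability R R) x : distr_fun mu x <= 1.
Proof. by rewrite -lee_fin distr_funE probability_le1. Qed.

Lemma cvg_distr_funy (R : realType) (mu : probability R R) (l : R) : 0 < l ->
  distr_fun mu (n%:R / l) @[n --> \oo] --> (1 : R).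
Proof.
move=> l0.
have : mu `]-oo, (n%:R / l)%R] @[n --> \oo] --> 1%E.
  rewrite -(probability_setT mu).
  have <- : \bigcup_n `]-oo, (n%:R / l)%R]%classic = [set: R].
    rewrite -subTset => x _; exists (Num.truncn (x * l)).+1 => //=.
    by rewrite in_itv/= ler_pdivlMr// ltW// truncnS_gt.
  apply: (@nondecreasing_cvg_mu _ _ _ mu (fun n => `]-oo, (n%:R / l)%R]%classic)) => //.
    exact: bigcupT_measurable.
  move=> m n mn; apply/subsetPset; apply: subset_itvl.
  by rewrite bnd_simp ler_pM2r ?invr_gt0// ler_nat.
by move/fine_cvg.
Qed.

Lemma probability_pos (R : realType) (nu : probability R R) :
  nu `]-oo, 0%R] = 0%E -> nu `]0%R, +oo[ = 1%E.
Proof.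
move=> nu0; rewrite -setCitvl.
by rewrite probability_setC// nu0 sube0.
Qed.

Lemma mixing_fin_num (R : realType) (mu : probability R R) (B : R -> R) (x M t : R) :
  (forall u, 0 <= B u <= M) -> 0 <= t <= M -> {homo B : s u / s <= u} ->
  (\int[mu]_y (if 0 < y then B (x / y) else t)%:E)%E \is a fin_num.
Proof.
move=> BM /andP[t0 tM] ndB; rewrite ge0_fin_numE; last first.
  by apply: integral_ge0 => y _; case: ifPn => _; rewrite lee_fin//; case/andP: (BM (x / y)).
apply: (@le_lt_trans _ _ (\int[mu]_y M%:E)%E).
  apply: ge0_le_integral; first by [].
  - by move=> y _; case: ifPn => _; rewrite lee_fin//; case/andP: (BM (x / y)).
  - by apply/measurable_EFinP; exact: measurable_mixing.
  - by [].
  - by move=> y _; case: ifPn => _; rewrite lee_fin//; case/andP: (BM (x / y)).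
by rewrite integral_cst// [X in (_ * X)%E]probability_setT mule1 ltry.
Qed.

(** * Limits of the mixed integrals, with weight 1 and with weight [l] *)

Section product_limit.
Context {R : realType} (nu_ : nat -> probability R R) (nu mu : probability R R).
Let D := discontinuities (distr_fun nu).
Hypotheses (nu_pos : forall n, nu_ n `]-oo, 0%R] = 0%E)
  (nu_pos_lim : nu `]-oo, 0%R] = 0%E).
Hypothesis cvgF : forall t, ~ D t ->
  distr_fun (nu_ n) t @[n --> \oo] --> distr_fun nu t.

Lemma continuous_at0 : ~ D 0.
Proof.
apply; apply: distr_fun_continuous; apply: (subset_measure0 _ _ _ nu_pos_lim) => //.
by move=> _ ->; rewrite /= in_itv/=.
Qed.

Lemma integral_distr_funE (m : probability R R) u : m `]-oo, 0%R] = 0%E ->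
  (\int[m]_(l in `]0%R, u]) 1%:E = (distr_fun m u)%:E)%E.
Proof.
move=> m0; rewrite integral_cst// mul1e.
have m0F : distr_fun m 0 = 0 by rewrite /distr_fun m0.
have [u0|u0] := leP 0 u; first by rewrite [LHS](distr_fun_itv m u0) m0F subr0.
rewrite set_itv_ge ?measure0 ?bnd_simp -?leNgt ?ltW//.
by congr EFin; apply/le_anti; rewrite distr_fun_ge0/= -m0F distr_fun_nd// ltW.
Qed.

(** Tonelli with weight 1 gives the form of [cvg_mixing], with [B] the distribution function and
    total 1. *)
Lemma cvg_product_distr (x_ : nat -> R) (x : R) : (forall n, 0 <= x_ n) -> 0 <= x ->
  x_ n @[n --> \oo] --> x ->
  (forall t y, D t -> mu [set y] != 0%E -> x <> t * y) ->
  (\int[nu_ n]_(l in `]0%R, +oo[) (distr_fun mu (x_ n / l)))%R @[n --> \oo] -->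
  (\int[nu]_(l in `]0%R, +oo[) (distr_fun mu (x / l)))%R.
Proof.
move=> x_0 x0 xx xD.
have E (m : probability R R) z : m `]-oo, 0%R] = 0%E -> 0 <= z ->
    (\int[m]_(l in `]0%R, +oo[) (distr_fun mu (z / l))%:E)%E =
    (\int[mu]_y (if 0 < y then distr_fun m (z / y) else 1)%:E)%E.
  move=> m0 z0; have := @mixing_tonelli _ m mu (cst 1) z (measurable_cst _).
  move=> /(_ (fun _ _ => ler01) z0) /=.
  under eq_integral do rewrite mul1r.
  move=> ->; apply: eq_integral => y _; case: ifPn => y0.
    by rewrite integral_distr_funE.
  by rewrite integral_cst// [X in (_ * X)%E](probability_pos m0) mule1.
have Ex : fine (\int[mu]_y (if 0 < y then distr_fun nu (x / y) else 1)%:E)%E =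
    \int[nu]_(l in `]0%R, +oo[) (distr_fun mu (x / l)) by rewrite -E.
have Efin : (\int[mu]_y (if 0 < y then distr_fun nu (x / y) else 1)%:E)%E \is a fin_num.
  apply: (@mixing_fin_num _ _ _ _ 1) => [t||]; last exact: distr_fun_nd.
    by rewrite distr_fun_ge0 distr_fun_le1.
  by rewrite ler01 lexx.
rewrite -Ex; have : (\int[mu]_y (if 0 < y then distr_fun (nu_ n) (x_ n / y) else 1)%:E)%E
    @[n --> \oo] --> (\int[mu]_y (if 0 < y then distr_fun nu (x / y) else 1)%:E)%E.
  apply: (@cvg_mixing _ mu (fun n => distr_fun (nu_ n)) (distr_fun nu)
    (cst 1) 1 1 D x_ x (countable_discontinuities nu) continuous_at0) => //.
  - by move=> n; exact: distr_fun_nd.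
  - exact: distr_fun_nd.
  - by move=> n t; rewrite distr_fun_ge0 distr_fun_le1.
  - by move=> n; rewrite ler01 lexx.
  - exact: cvg_cst.
  - by move=> t /contrapT.
rewrite -(fineK Efin) => /fine_cvg; apply: cvg_trans; apply: near_eq_cvg.
by apply: nearW => n; rewrite /= -E.
Qed.

Hypothesis ui : forall e : R, 0 < e -> exists2 K : R, 0 <= K & forall n,
  (\int[nu_ n]_(l in `]0%R, +oo[) (l * (K <= l)%R%:R)%:E <= e%:E)%E.

(** Tonelli with weight [l] turns [B] into the truncated mean and the total into the mean. Uniform
    integrability gives the common bound [M] and the convergence of the totals. *)
Lemma cvg_product_mean (x_ : nat -> R) (x : R) : (forall n, 0 <= x_ n) -> 0 <= x ->
  x_ n @[n --> \oo] --> x ->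
  (forall t y, D t -> mu [set y] != 0%E -> x <> t * y) ->
  (\int[nu_ n]_(l in `]0%R, +oo[) (l * distr_fun mu (x_ n / l)))%R @[n --> \oo] -->
  (\int[nu]_(l in `]0%R, +oo[) (l * distr_fun mu (x / l)))%R.
Proof.
move=> x_0 x0 xx xD.
have E (m : probability R R) z :
    (mean m)%:E = (\int[m]_(l in `]0%R, +oo[) l%:E)%E -> 0 <= z ->
    (\int[m]_(l in `]0%R, +oo[) (l * distr_fun mu (z / l))%:E)%E =
    (\int[mu]_y (if 0 < y then trunc_mean m (z / y) else mean m)%:E)%E.
  move=> mm z0; have := @mixing_tonelli _ m mu id z (@measurable_id _ _ _).
  move=> /(_ (fun _ => @ltW _ _ _ _) z0) /= ->.
  by apply: eq_integral => y _; case: ifPn => y0; rewrite -?mm ?trunc_meanE.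
have tm0 (m : probability R R) t : 0 <= trunc_mean m t.
  by rewrite -lee_fin trunc_meanE trunc_mean_ge0.
have tmle (m : probability R R) t :
    (mean m)%:E = (\int[m]_(l in `]0%R, +oo[) l%:E)%E -> trunc_mean m t <= mean m.
  by move=> mm; rewrite -lee_fin mm trunc_mean_le_mean.
have mean0 (m : probability R R) :
    (mean m)%:E = (\int[m]_(l in `]0%R, +oo[) l%:E)%E -> 0 <= mean m.
  by move=> mm; exact: le_trans (tm0 m 0) (tmle m 0 mm).
have mnu := limit_mean_finite cvgF ui; have mnu_ := mean_finite ui.
have [M meanM] := mean_bounded ui.
have meanM' n : mean (nu_ n) <= M by rewrite -lee_fin mnu_.
have Ex : fine (\int[mu]_y (if 0 < y then trunc_mean nu (x / y) else mean nu)%:E)%E =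
    \int[nu]_(l in `]0%R, +oo[) (l * distr_fun mu (x / l)) by rewrite -E.
have Efin : (\int[mu]_y (if 0 < y then trunc_mean nu (x / y) else mean nu)%:E)%E \is a fin_num.
  apply: (@mixing_fin_num _ _ _ _ (mean nu)) => [t||].
  - by rewrite tm0 tmle.
  - by rewrite mean0 ?lexx.
  - exact: trunc_mean_nd.
rewrite -Ex.
have : (\int[mu]_y
     (if 0 < y then trunc_mean (nu_ n) (x_ n / y) else mean (nu_ n))%:E)%E
    @[n --> \oo] --> (\int[mu]_y (if 0 < y then trunc_mean nu (x / y) else mean nu)%:E)%E.
  apply: (@cvg_mixing _ mu (fun n => trunc_mean (nu_ n)) (trunc_mean nu)
    (fun n => mean (nu_ n)) (mean nu) M D x_ x
    (countable_discontinuities nu) continuous_at0) => //.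
  - by move=> n; exact: trunc_mean_nd.
  - exact: trunc_mean_nd.
  - by move=> n t; rewrite tm0 (le_trans (tmle _ _ (mnu_ n))).
  - by move=> n; rewrite mean0/=.
  - exact: cvg_mean.
  - by move=> t; exact: cvg_trunc_mean.
  - by move=> t /contrapT; exact: trunc_mean_continuous.
rewrite -(fineK Efin) => /fine_cvg; apply: cvg_trans; apply: near_eq_cvg.
by apply: nearW => n; rewrite /= -E.
Qed.

(** By Markov's inequality a zero mean would leave no mass on any [[a, +oo[] with [a > 0], hence
    none on []0, +oo[]. This keeps the limiting denominator away from 0. *)
Lemma limit_mean_gt0 : 0 < mean nu.
Proof.
have mnu := limit_mean_finite cvgF ui.
rewrite lt_neqAle; apply/andP; split; last first.
  by rewrite fine_ge0// integral_ge0// => l /=; rewrite in_itv/= andbT lee_fin => /ltW.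
apply/eqP => mean0.
have nua (a : R) : 0 < a -> nu `[a, +oo[ = 0%E.
  move=> a0; apply/eqP; rewrite -measure_le0.
  have : (a%:E * nu `[a, +oo[ <= 0)%E.
    have -> : 0%E = (\int[nu]_(l in `]0%R, +oo[) l%:E)%E by rewrite -mnu -mean0.
    rewrite -integral_cst//.
    apply: (@le_trans _ _ (\int[nu]_(l in `[a, +oo[) l%:E)%E).
      apply: ge0_le_integral => //.
        by move=> l _; rewrite lee_fin ltW.
      by move=> l /=; rewrite in_itv/= andbT lee_fin.
    apply: ge0_subset_integral => //.
      by move=> l /=; rewrite in_itv/= andbT lee_fin => /ltW.
    by apply: subset_itvr; rewrite bnd_simp.
  by rewrite pmule_rle0 // lte_fin.
have := probability_pos nu_pos_lim; rewrite itvoyEbigcup => nu1.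
have : nu (\bigcup_k `[0 + k.+1%:R^-1, +oo[) = 0%E.
  apply: measure_negligible; first exact: bigcupT_measurable.
  apply: negligible_bigcup => k; exists `[0 + k.+1%:R^-1, +oo[%classic.
  by split => //; apply: nua; rewrite add0r.
by rewrite nu1 => /eqP; rewrite onee_eq0.
Qed.

End product_limit.

Section product_distr.
Context {R : realType} (nu mu : probability R R).
Hypothesis nu_pos : nu `]-oo, 0%R] = 0%E.

Lemma measurable_product_distr x :
  measurable_fun (`]0%R, +oo[%classic : set R) (fun l : R => distr_fun mu (x / l)).
Proof.
apply: measurable_funTS; apply: measurableT_comp; first exact: measurable_distr_fun.
by apply: measurable_funM => //; exact: measurable_inv.
Qed.

Lemma integral_product_distr_fin_num x :
  (\int[nu]_(l in `]0%R, +oo[) (distr_fun mu (x / l))%:E)%E \is a fin_num.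
Proof.
rewrite ge0_fin_numE; last by apply: integral_ge0 => l _; rewrite lee_fin distr_fun_ge0.
apply: (@le_lt_trans _ _ (\int[nu]_(l in `]0%R, +oo[) 1%:E)%E).
  apply: ge0_le_integral => //.
  - by move=> l _; rewrite lee_fin distr_fun_ge0.
  - by apply/measurable_EFinP; exact: measurable_product_distr.
  - by move=> l _; rewrite lee_fin distr_fun_le1.
by rewrite integral_cst// [X in (_ * X)%E](probability_pos nu_pos) mule1 ltry.
Qed.

Lemma product_distr_nd x y : 0 <= x -> x <= y ->
  \int[nu]_(l in `]0%R, +oo[) (distr_fun mu (x / l)) <=
  \int[nu]_(l in `]0%R, +oo[) (distr_fun mu (y / l)).
Proof.
move=> x0 xy; apply: fine_le; try exact: integral_product_distr_fin_num.
apply: ge0_le_integral => //.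
- by move=> l _; rewrite lee_fin distr_fun_ge0.
- by apply/measurable_EFinP; exact: measurable_product_distr.
- by apply/measurable_EFinP; exact: measurable_product_distr.
- move=> l /=; rewrite in_itv/= andbT => l0.
  by rewrite lee_fin distr_fun_nd// ler_pM2r// invr_gt0.
Qed.

(** Dominated convergence along [x = n]. It makes the set defining the quantile nonempty at every
    level below 1. *)
Lemma product_distr_lt1 q : q < 1 ->
  exists2 x, 0 <= x & q <= \int[nu]_(l in `]0%R, +oo[) (distr_fun mu (x / l)).
Proof.
move=> q1.
have : (\int[nu]_(l in `]0%R, +oo[) (distr_fun mu (n%:R / l))%:E)%E @[n --> \oo] -->
    (\int[nu]_(l in `]0%R, +oo[) 1%:E)%E.
  apply: (@dominated_cvgR _ _ _ nu _ (fun n l => distr_fun mu (n%:R / l)) (cst 1) (cst 1)) => //.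
  - by move=> n; exact: measurable_product_distr.
  - by apply: aeW => l /=; rewrite in_itv/= andbT; exact: cvg_distr_funy.
  - exact: finite_measure_integrable_cst.
  - by move=> n l _; rewrite ger0_norm ?distr_fun_ge0// distr_fun_le1.
rewrite integral_cst// [X in (_ * X)%E](probability_pos nu_pos) mule1.
move=> /fine_cvg/cvgr_ge/(_ _ q1)[n _ /(_ n (leqnn n)) qn].
by exists n%:R.
Qed.

End product_distr.

(** * The miss probability *)

Section empirical_measure.
Context {R : realType} (n : nat) (lam : 'I_n.+1 -> R).

Lemma integral_empirical (D : set R) (f : R -> R) :
  measurable D -> (forall i, D (lam i)) -> measurable_fun D f ->
  (forall l, D l -> 0 <= f l) ->
  (\int[empirical lam]_(l in D) (f l)%:E)%E =
  (n.+1%:R^-1 * \sum_(i < n.+1) f (lam i))%:E.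
Proof.
move=> mD Dlam mf f0.
have mfE : measurable_fun D (EFin \o f) by exact/measurable_EFinP.
have fE0 l : D l -> (0 <= (f l)%:E)%E by move=> Dl; rewrite lee_fin f0.
rewrite /empirical ge0_integral_mscale//= EFinM; congr (_ * _)%E.
(* Finite sums of measures are indexed by natural numbers, hence the passage from ordinals through
   [inord]. *)
pose m_ k : {measure set R -> \bar R} := \d_(lam (inord k)).
rewrite (@eq_measure_integral _ _ _ _ (msum m_ n.+1)); last first.
  move=> A mA _; rewrite /msum /=; rewrite /sum_measure.
  by apply: eq_bigr => i _; rewrite /m_ inord_val.
rewrite ge0_integral_measure_sum// -sumEFin; apply: eq_bigr => i _.
by rewrite /m_ inord_val integral_dirac//= diracE mem_set// mul1e.
Qed.

Lemma empirical_probability :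
  exists m : probability R R, m = empirical lam :> (set R -> \bar R).
Proof.
have E1 : empirical lam setT = 1%E.
  have := @integral_empirical setT (fun=> 1) measurableT (fun=> I) (measurable_cst _)
    (fun _ _ => ler01).
  rewrite integral_cst// mul1e => ->.
  by rewrite sumr_const card_ord -mulr_natr mul1r mulVf// pnatr_eq0.
by exists (HB.pack_for (probability R R) (Measure.sort (empirical lam))
  (@Measure_isProbability.Build _ _ _ (empirical lam) E1)).
Qed.

End empirical_measure.

(** At continuity points below 0 the limit distribution function is 0, so a weak limit of laws on
    []0, +oo[] can charge []-oo, 0]] only at 0. *)
Lemma weak_limit_pos (R : realType) (nu_ : nat -> probability R R)
    (nu : probability R R) :
  (forall n, nu_ n `]-oo, 0%R] = 0%E) ->
  (forall t, ~ discontinuities (distr_fun nu) t ->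
    distr_fun (nu_ n) t @[n --> \oo] --> distr_fun nu t) ->
  nu [set 0%R] = 0%E -> nu `]-oo, 0%R] = 0%E.
Proof.
move=> nu_pos cvgF nu0.
have neg x : x < 0 -> distr_fun nu x = 0.
  move=> x0; have [t /andP[xt t0] Dt] := countable_avoid (countable_discontinuities nu) x0.
  have nut : distr_fun nu t = 0.
    apply/esym; apply: (cvg_unique _ _ (cvgF t Dt)) => //.
    apply: cvg_near_cst; apply: nearW => n; apply/le_anti.
    rewrite distr_fun_ge0 andbT -lee_fin distr_funE -[leRHS](nu_pos n).
    by apply: le_measure; rewrite ?inE//; apply: subset_itvl; rewrite bnd_simp ltW.
  by apply/le_anti; rewrite distr_fun_ge0 andbT -nut distr_fun_nd// ltW.
rewrite -(@setUitv1 _ _ _ _ true)//; apply: null_set_setU => //.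
rewrite (_ : `]-oo, 0%R[%classic = \bigcup_k `]-oo, (- k.+1%:R^-1)%R]%classic).
  apply: measure_negligible; first exact: bigcupT_measurable.
  apply: negligible_bigcup => k; exists `]-oo, (- k.+1%:R^-1)%R]%classic.
  by split => //; rewrite -[LHS]distr_funE neg// oppr_lt0.
apply/seteqP; split=> [t|t [k _]] /=; rewrite !in_itv/=.
  move=> /ltr_add_invr[k tk]; exists k => //=.
  by rewrite in_itv/= -[leRHS]add0r lerBrDr ltW.
by move=> /le_lt_trans; apply; rewrite oppr_lt0.
Qed.

(** [mu] is the law of the hazard rate under [H]; the product limits thereby apply to both G and
    G_0. *)
Lemma hazard_distr_probability (R : realType) (F0 : probability R R) (f0 : R -> R)
    (H : probability R R) : has_density F0 f0 -> H `]-oo, 0%R[ = 0%E ->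
  exists mu : probability R R, hazard_distr F0 f0 H = distr_fun mu.
Proof.
move=> df0 H0; have [mu muE] := pushforward_probability H (measurable_hazard df0).
exists mu; apply/funext => x; rewrite hazard_distrE// /distr_fun muE.
by congr (fine (H _)); apply/seteqP; split => t /=; rewrite in_itv.
Qed.

(** At [t = 0] the age formula integrates over a single point. *)
Lemma age_distribution_pos (R : realType) (F0 F : probability R R) :
  age_distribution F0 F -> F `]-oo, 0%R[ = 0%E.
Proof.
move=> /(_ 0 (lexx _)); rewrite set_itv1 integral_set1 => F00.
by apply: (subset_measure0 _ _ _ F00) => //; apply: subset_itvl; rewrite bnd_simp.
Qed.

Lemma threshold_ge0 (R : realType) d (T : measurableType d) (P : probability T R)
    (F0 : probability R R) (f0 : R -> R) (N : nat) (lam : 'I_N -> R)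
    (Phi : 'I_N -> R.-ker T ~> R) (C : nat) :
  0 <= threshold P F0 f0 lam Phi C.
Proof.
rewrite /threshold; set S := [set _ | _].
have [->|/set0P S0] := eqVneq S set0; first by rewrite inf0.
by apply: lb_le_inf => // x [].
Qed.

Lemma miss_probabilityE (R : realType) d (T : measurableType d) (P : probability T R)
    (theta : R -> T -> T) (F0 : probability R R) (f0 : R -> R) (N : nat)
    (lam : 'I_N -> R) (Phi : 'I_N -> R.-ker T ~> R) (th : R) :
  F0 `]-oo, 0%R[ = 0%E -> has_density F0 f0 ->
  memory_system P theta F0 lam Phi ->
  miss_probability P theta F0 f0 lam Phi th =
  (\sum_(i < N) lam i * hazard_distr F0 f0 F0 (th / lam i)) / \sum_(i < N) lam i.
Proof.
move=> F00 df0 [flow lam0 _ _ renewal]; rewrite mulr_suml; apply: eq_bigr => i _.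
have := palm_rate_distr th F00 df0 flow (lam0 i) (renewal i).
by rewrite mulrAC /policy /rate /item_hazard /= => ->.
Qed.

Theorem proposition3 (R : realType)
  (F0 : probability R R) (f0 : R -> R) (F : probability R R)
  (F0_Rplus : F0 `]-oo, 0%R[ = 0%E)
  (F0_density : has_density F0 f0)
  (F0_mean : (\int[F0]_t t%:E = 1)%E)
  (F_age : age_distribution F0 F)
  (G := hazard_distr F0 f0 F) (G0 := hazard_distr F0 f0 F0)
  (d : nat -> measure_display) (Omega : forall N, measurableType (d N))
  (P : forall N, probability (Omega N) R)
  (theta : forall N, R -> Omega N -> Omega N)
  (lam : forall N, 'I_N -> R)
  (Phi : forall N, 'I_N -> R.-ker (Omega N) ~> R)
  (C : nat -> nat)
  (C_bounds : forall N, (1 < N)%N -> (1 <= C N < N)%N)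
  (system : forall N, (1 < N)%N ->
     memory_system (P N) (theta N) F0 (lam N) (Phi N))
  (L : probability R R)
  (L_cvg : weak_cvg (fun N => empirical (lam N)) L)
  (L_no_atom : L [set 0%R] = 0%E)
  (no_ties : forall N, (1 < N)%N -> forall i j : 'I_N, i <> j ->
     palm (P N) (theta N) (superposition (Phi N))
       [set w | observed_hazard F0 f0 (lam N) (Phi N) i w =
                observed_hazard F0 f0 (lam N) (Phi N) j w] = 0%E)
  (lam_ui : uniformly_integrable lam)
  (thetaN := fun N => threshold (P N) F0 f0 (lam N) (Phi N) (C N))
  (thetaN_attained : forall N, (1 < N)%N ->
     \int[empirical (lam N)]_(l in `]0%R, +oo[) G (thetaN N / l)
     = 1 - (C N)%:R / N%:R)
  (Q := limit_quantile G L)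
  (c : R) (c_range : 0 < c <= 1)
  (Q_cont : Q p @[p --> within `[0%R, 1%R] (nbhs (1 - c))] --> Q (1 - c))
  (thetastar := Q (1 - c))
  (thetastar_ok :
     ~ [set l * x | l in discontinuities (distr_fun L) &
                    x in discontinuities G0] thetastar)
  (C_cvg : (C N)%:R / N%:R @[N --> \oo] --> c) :
  miss_probability (P N) (theta N) F0 f0 (lam N) (Phi N) (thetaN N)
    @[N --> \oo] -->
  (\int[L]_(l in `]0%R, +oo[) (l * G0 (thetastar / l))) /
  (\int[L]_(l in `]0%R, +oo[) l).
Proof.
(* The systems are given for [N > 1], so all sequences are reindexed by [n.+2]. *)
have lam_gt0 n i : 0 < lam n.+2 i by have [_ + _ _ _] := system n.+2 isT; apply.
have [nu_ nu_E] : {nu_ : nat -> probability R R &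
    forall n, nu_ n = empirical (lam n.+2) :> (set R -> \bar R)}.
  apply: (@choice _ _ (fun n (m : probability R R) =>
    m = empirical (lam n.+2) :> (set R -> \bar R))) => n.
  exact: empirical_probability.
have nu_empirical n (A : set R) (f : R -> \bar R) :
    (\int[nu_ n]_(l in A) f l = \int[empirical (lam n.+2)]_(l in A) f l)%E.
  by apply: eq_measure_integral => B _ _; exact: (congr1 (@^~ B) (nu_E n)).
have nu_int n (f : R -> R) : measurable_fun (`]0%R, +oo[%classic : set R) f ->
    (forall l, 0 < l -> 0 <= f l) ->
    (\int[nu_ n]_(l in `]0%R, +oo[) (f l)%:E)%E =
    (n.+2%:R^-1 * \sum_(i < n.+2) f (lam n.+2 i))%:E.
  move=> mf f0'; rewrite nu_empirical integral_empirical//.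
  - by move=> i; rewrite /= in_itv/= andbT.
  - by move=> l /=; rewrite in_itv/= andbT; exact: f0'.
have nu_pos n : nu_ n `]-oo, 0%R] = 0%E.
  have nu1 : nu_ n `]0%R, +oo[ = 1%E.
    have := nu_int n (fun=> 1) (measurable_cst _) (fun _ _ => ler01).
    rewrite integral_cst// mul1e => ->.
    by rewrite sumr_const card_ord -mulr_natr mul1r mulVf// pnatr_eq0.
  by rewrite -setCitvr probability_setC// nu1 subee.
pose D := discontinuities (distr_fun L).
have nu_cvg t : ~ D t -> distr_fun (nu_ n) t @[n --> \oo] --> distr_fun L t.
  move=> /contrapT /L_cvg; rewrite -(cvg_shiftn 2); apply: cvg_trans.
  by apply: near_eq_cvg; apply: nearW => n; rewrite /= addn2 /distr_fun nu_E.
have L_pos := weak_limit_pos nu_pos nu_cvg L_no_atom.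
have nu_ui e : 0 < e -> exists2 K : R, 0 <= K & forall n,
    (\int[nu_ n]_(l in `]0%R, +oo[) (l * (K <= l)%R%:R)%:E <= e%:E)%E.
  move=> /lam_ui[K K0 lamK]; exists K => // n.
  rewrite nu_int; last 2 first.
  - apply: measurable_funM => //; apply: nondecreasing_measurable => // x y xy.
    by rewrite ler_nat; case: (leP K x) => // Kx; rewrite (le_trans Kx).
  - by move=> l l0; rewrite mulr_ge0// ltW.
  rewrite lee_fin; apply: le_trans (lamK n.+2 isT).
  rewrite ler_wpM2l// [leRHS]big_mkcond ler_sum// => i _.
  by case: ifP; rewrite ?mulr1 ?mulr0.
have [muG GE] := hazard_distr_probability F0_density (age_distribution_pos F_age).
have [mu0 G0E] := hazard_distr_probability F0_density F0_Rplus.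
pose th_ n := thetaN n.+2.
have th_ge0 n : 0 <= th_ n by exact: threshold_ge0.
have th_cvg : th_ n @[n --> \oo] --> thetastar.
  (* Outside [E] a level is no product of discontinuity points of L and G; [E] is countable, as the
     quantile argument requires. *)
  pose E := [set z.1 * z.2 | z in D `*` discontinuities (distr_fun muG)].
  have cE : countable E.
    apply: sub_countable (card_image_le _ _) _; apply: countableX;
      exact: countable_discontinuities.
  have QE : Q = limit_quantile (distr_fun muG) L by rewrite /Q /G GE.
  rewrite /thetastar QE; rewrite QE in Q_cont.
  apply: (@cvg_quantile _
    (fun n x => \int[nu_ n]_(l in `]0%R, +oo[) (distr_fun muG (x / l)))
    (limit_distr (distr_fun muG) L) (fun n => 1 - (C n.+2)%:R / n.+2%:R) th_ _ E) => //.
  - by move=> n x y; exact: product_distr_nd.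
  - by move=> x y; exact: product_distr_nd.
  - by apply: Rintegral_ge0 => l _; exact: distr_fun_ge0.
  - by move=> q; exact: product_distr_lt1.
  - move=> x x0 Ex; apply: cvg_product_distr => //; first exact: cvg_cst.
    move=> t y Dt muy xty; apply: Ex; exists (t, y) => //=; split => //=.
    by move=> /continuous_distr_fun muy0; rewrite muy0 eqxx in muy.
  (* Equality in the memory constraint: the mixed distribution function takes the value
     [1 - C N / N] at the threshold. *)
  - by move=> n; rewrite /Rintegral nu_empirical -thetaN_attained// /G GE.
  - apply: cvgB; first exact: cvg_cst.
    move: C_cvg; rewrite -(cvg_shiftn 2); apply: cvg_trans.
    by apply: near_eq_cvg; apply: nearW => n; rewrite /= addn2.
  - lra.
have L_mean := limit_mean_gt0 L_pos nu_cvg nu_ui.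
pose miss N := miss_probability (P N) (theta N) F0 f0 (lam N) (Phi N) (thetaN N).
(* The factors [1 / N] of the two empirical integrals cancel in the quotient. *)
have missE n : miss n.+2 =
    (\int[nu_ n]_(l in `]0%R, +oo[) (l * distr_fun mu0 (th_ n / l))) / mean (nu_ n).
  rewrite /miss miss_probabilityE//; last exact: system.
  rewrite G0E /mean /Rintegral !nu_int//=.
  - by rewrite invfM invrK mulrACA mulVf ?mul1r// pnatr_eq0.
  - by move=> l /ltW.
  - by apply: measurable_funM => //; exact: measurable_product_distr.
  - by move=> l l0; rewrite mulr_ge0 ?distr_fun_ge0// ltW.
rewrite -/miss -(cvg_shiftn 2) /G0 G0E.
suff : (\int[nu_ n]_(l in `]0%R, +oo[) (l * distr_fun mu0 (th_ n / l))) / mean (nu_ n)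
    @[n --> \oo] --> (\int[L]_(l in `]0%R, +oo[) (l * distr_fun mu0 (thetastar / l))) / mean L.
  apply: cvg_trans; apply: near_eq_cvg; apply: nearW => n.
  by rewrite /= addn2 missE.
apply: cvgM; last by apply: cvgV; [rewrite gt_eqF|exact: cvg_mean].
apply: cvg_product_mean => //.
  by apply: cvgr_to_ge th_cvg _; exact: nearW.
(* An atom of [mu0] is a discontinuity point of G_0, so writing the limit threshold as [t * y] would
   contradict the hypothesis on it. *)
move=> t y Dt muy xty; apply: thetastar_ok; exists t => //; exists y => //.
by rewrite /G0 G0E => /continuous_distr_fun muy0; rewrite muy0 eqxx in muy.
Qed.
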